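(* Let $d\ge2$ and let $K\in L^2(\mathbb{S}^{d-1}\times\mathbb{S}^{d-1})$ be a Hermitian kernel with expansion $$K(\xi,\zeta)=\sum_{j,j'=0}^{\infty}\sum_{k=1}^{N_{j,d}}\sum_{k'=1}^{N_{j',d}}a_{j,j',k,k'}\,Y_j^k(\xi)\,\overline{Y_{j'}^{k'}(\zeta)} .$$ Then $$\int_{\mathbb{S}^{d-1}}K(\xi,\cdot)\,\overline{Y(\xi)}\,d\sigma(\xi)\in H_j\qquad\text{for all } j\ge 0 \text{ and all } Y\in H_j$$ if and only if the coefficients have the form $a_{j,j',k,k'}=\delta_{j,j'}\,d_j(k,k')$ for all $j,j'\ge0$, $1\le k\le N_{j,d}$, $1\le k'\le N_{j',d}$, for some numbers $d_j(k,k')\in\mathbb{C}$.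
   Context: $\mathbb{S}^{d-1}$ is the unit sphere in $\mathbb{R}^d$ with surface measure $\sigma$. $H_j$ is the space of (complex-valued) spherical harmonics of degree $j$, $N_{j,d}=\dim H_j$, and $Y_j^1,\ldots,Y_j^{N_{j,d}}$ is a fixed orthonormal basis of $H_j$ in $L^2(\mathbb{S}^{d-1})$. The expansion of $K$ is understood in $L^2(\mathbb{S}^{d-1}\times\mathbb{S}^{d-1})$, and membership in $H_j$ as elements of $L^2(\mathbb{S}^{d-1})$. Hermitian means $K(\xi,\zeta)=\overline{K(\zeta,\xi)}$. *)

(* Defs.v *)
From HB Require Import structures.
From mathcomp Require Import all_boot all_order all_algebra.
From mathcomp Require Import complex.
Set Implicit Arguments.
Unset Strict Implicit.
Unset Printing Implicit Defensive.

(* mpoly is imported in a module of its own because its notations are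
   incompatible with those of the analysis library. *)
Module SolidHarmonic.
From mathcomp Require Import mpoly.
Import GRing.Theory.
Local Open Scope ring_scope.

Section solid_harmonic.
Context (F : comNzRingType) (d : nat).

Definition laplacian (p : {mpoly F[d]}) : {mpoly F[d]} :=
  \sum_(i < d) p^`M(i)^`M(i).

Definition solid_harmonic (j : nat) (p : {mpoly F[d]}) :=
  p \is j.-homog /\ laplacian p = 0.

Definition eval (p : {mpoly F[d]}) (x : d.-tuple F) : F := p.@[tnth x].

End solid_harmonic.
End SolidHarmonic.

From mathcomp Require Import all_classical all_reals all_analysis.
From mathcomp Require Import measurable_realfun.
Import Order.TTheory GRing.Theory Num.Theory.
Import numFieldNormedType.Exports.
Local Open Scope classical_set_scope.
Local Open Scope ring_scope.

(* R^d; the library equips tuples with the product sigma-algebra. *)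
Notation euclidean R d := (d.-tuple (measurableTypeR R)).

(* The library's own instance is masked by the one for pairs of
   subprobabilities, so canonical inference does not find it. *)
Lemma product_sigma_finite d1 d2 (T1 : measurableType d1)
    (T2 : measurableType d2) (R : realType)
    (m1 : {sigma_finite_measure set T1 -> \bar R})
    (m2 : {sigma_finite_measure set T2 -> \bar R}) :
  sigma_finite setT (m1 \x m2)%E.
Proof.
have /sigma_finiteP[F [TF ndF Foo]] := sigma_finiteT m1.
have /sigma_finiteP[G [TG ndG Goo]] := sigma_finiteT m2.
exists (fun n => F n `*` G n).
  rewrite -setXTT TF TG predeqE => -[x y]; split.
    move=> [/= [n _ Fnx] [k _ Gky]]; exists (maxn n k) => //; split.
    - by move: x Fnx; exact/subsetPset/ndF/leq_maxl.
    - by move: y Gky; exact/subsetPset/ndG/leq_maxr.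
  by move=> [n _ []/= ? ?]; split; exists n.
move=> k; have [mF Fk] := Foo k; have [mG Gk] := Goo k.
split; first exact: measurableX.
by rewrite product_measure1E// lte_mul_pinfty// ge0_fin_numE.
Qed.

Section lebesgue_measure_step.
Context (R : realType) (n : nat).
Variable mu : {sigma_finite_measure set (euclidean R n) -> \bar R}.

Definition cons_euclidean (x : measurableTypeR R * euclidean R n) :
  euclidean R n.+1 := [tuple of x.1 :: x.2].

Lemma measurable_cons_euclidean : measurable_fun setT cons_euclidean.
Proof. exact: measurable_cons. Qed.

HB.instance Definition _ :=
  isMeasurableFun.Build _ _ _ _ cons_euclidean measurable_cons_euclidean.

Definition lebesgue_measure_step : set (euclidean R n.+1) -> \bar R :=
  pushforward (@lebesgue_measure R \x mu)%E cons_euclidean.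

Let step0 : lebesgue_measure_step set0 = 0%E.
Proof. exact: measure0. Qed.

Let step_ge0 A : (0 <= lebesgue_measure_step A)%E.
Proof. exact: measure_ge0. Qed.

Let step_sigma_additive : semi_sigma_additive lebesgue_measure_step.
Proof. exact: measure_semi_sigma_additive. Qed.

HB.instance Definition _ := isMeasure.Build _ _ _ lebesgue_measure_step
  step0 step_ge0 step_sigma_additive.

Let step_sigma_finite : sigma_finite setT lebesgue_measure_step.
Proof.
have [F FT Foo] := product_sigma_finite (@lebesgue_measure R) mu.
pose split_tuple (x : euclidean R n.+1) : measurableTypeR R * euclidean R n :=
  (thead x, [tuple of behead x]).
have msplit : measurable_fun setT split_tuple.
  apply/measurable_fun_pairP; split; last exact: measurable_behead.
  exact: measurable_tnth.
have consK : cancel cons_euclidean split_tuple.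
  by case=> x y; congr (_, _); apply: val_inj.
exists (fun k => split_tuple @^-1` F k).
  by rewrite -preimage_bigcup -FT preimage_setT.
move=> k; have [mFk Fkoo] := Foo k; split.
  by rewrite -[X in measurable X]setTI; exact: msplit.
rewrite /lebesgue_measure_step /pushforward -comp_preimage.
by rewrite (_ : split_tuple \o cons_euclidean = id)//; apply/funext/consK.
Qed.

HB.instance Definition _ := Measure_isSigmaFinite.Build _ _ _
  lebesgue_measure_step step_sigma_finite.

End lebesgue_measure_step.

Fixpoint euclidean_lebesgue (R : realType) (d : nat) :
    {sigma_finite_measure set (euclidean R d) -> \bar R} :=
  match d with
  | 0 => \d_([tuple] : euclidean R 0)
  | n.+1 => lebesgue_measure_step (euclidean_lebesgue R n)
  end.

Lemma euclidean_lebesgue_cube (R : realType) (d : nat) :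
  let cube := [set x : euclidean R d | forall i, -1 <= (tnth x i : R) <= 1] in
  measurable cube /\ (euclidean_lebesgue R d cube < +oo)%E.
Proof.
elim: d => [|n [mcube cubeoo]] /=.
  rewrite (_ : [set _ | _] = setT); last by apply/seteqP; split => // x _ [].
  by split => //; rewrite diracT ltry.
set cube := [set x : euclidean R n | _] in mcube cubeoo.
set cube' := [set x : euclidean R n.+1 | _].
pose I : set (measurableTypeR R) := [set` `[(-1)%R, 1%R] ].
have mI : measurable I by exact: measurable_itv.
pose hd (x : euclidean R n.+1) : measurableTypeR R := tnth x ord0.
pose tl (x : euclidean R n.+1) : euclidean R n := [tuple of behead x].
have cubeE : cube' = hd @^-1` I `&` tl @^-1` cube.
  apply/seteqP; split => x.
    move=> x1; split => [|i]; first by rewrite /I /= in_itv/= x1.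
    by rewrite [x]tuple_eta in x1; have := x1 (lift ord0 i); rewrite tnthS.
  case=> /= x0 x1 i; have [j ->|->] := unliftP ord0 i.
    by have := x1 j; rewrite [in X in _ -> X](tuple_eta x) tnthS.
  by move: x0; rewrite /I /= in_itv.
split.
  rewrite cubeE; apply: measurableI; rewrite -[X in measurable X]setTI.
    exact: measurable_tnth.
  exact: measurable_behead.
rewrite /lebesgue_measure_step /pushforward.
rewrite (_ : _ @^-1` _ = I `*` cube); last first.
  rewrite cubeE preimage_setI -!comp_preimage.
  have -> : hd \o @cons_euclidean R n = fst by apply/funext.
  have -> : tl \o @cons_euclidean R n = snd.
    by apply/funext => -[x y]; exact: val_inj.
  by [].
have Ioo : (lebesgue_measure I < +oo)%E.
  by rewrite /I lebesgue_measure_itv/= lte_fin ifT -?EFinB ?ltry// -subr_gt0.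
by rewrite product_measure1E// lte_mul_pinfty// ge0_fin_numE.
Qed.

Section surface_measure.
Context (R : realType) (d : nat).
Implicit Types x : euclidean R d.

Definition euclidean_norm x : R := Num.sqrt (\sum_(i < d) tnth x i ^+ 2).

Definition sphere : set (euclidean R d) := [set x | euclidean_norm x = 1].

Definition punctured_ball : set (euclidean R d) :=
  [set x | 0 < euclidean_norm x <= 1].

Definition normalize x : euclidean R d :=
  [tuple (tnth x i / euclidean_norm x : R) | i < d].

Lemma measurable_euclidean_norm : measurable_fun setT euclidean_norm.
Proof.
apply: (@measurableT_comp _ _ _ _ _ _ (@Num.sqrt R)).
  by apply: continuous_measurable_fun; exact: sqrt_continuous.
apply: measurable_sum => i; apply: measurable_funX.
exact: (@measurable_tnth _ (measurableTypeR R) d i).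
Qed.

Lemma measurable_punctured_ball : measurable punctured_ball.
Proof.
rewrite (_ : punctured_ball = euclidean_norm @^-1` `]0, 1]); last first.
  by apply/seteqP; split => x /=; rewrite in_itv.
rewrite -[X in measurable X]setTI; apply: measurable_euclidean_norm => //.
Qed.

Lemma measurable_normalize : measurable_fun setT normalize.
Proof.
apply/measurable_fun_tnthP => i.
rewrite (_ : _ \o _ = fun x : euclidean R d =>
    (tnth x i : R) * euclidean_norm x `^ (-1)); last first.
  by apply/funext => x/=; rewrite tnth_mktuple powR_inv1// sqrtr_ge0.
apply: (@measurable_funM _ _ R); first exact: measurable_tnth.
apply: (@measurableT_comp _ _ _ _ _ _ (@powR R ^~ (-1))).
  exact: measurable_powR.
exact: measurable_euclidean_norm.
Qed.

HB.instance Definition _ :=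
  isMeasurableFun.Build _ _ _ _ normalize measurable_normalize.

(* A |-> Lebesgue measure of {r x | x in A, 0 < r <= 1} for A in the sphere *)
Definition cone_measure : set (euclidean R d) -> \bar R :=
  pushforward (mrestr (euclidean_lebesgue R d) measurable_punctured_ball)
    normalize.

Let cone0 : cone_measure set0 = 0%E.
Proof. exact: measure0. Qed.

Let cone_ge0 A : (0 <= cone_measure A)%E.
Proof. exact: measure_ge0. Qed.

Let cone_sigma_additive : semi_sigma_additive cone_measure.
Proof. exact: measure_semi_sigma_additive. Qed.

HB.instance Definition _ := isMeasure.Build _ _ _ cone_measure
  cone0 cone_ge0 cone_sigma_additive.

Let cone_finite : fin_num_fun cone_measure.
Proof.
apply: lty_fin_num_fun => //; rewrite /= /cone_measure /pushforward /mrestr.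
rewrite preimage_setT setTI.
have [mcube] := euclidean_lebesgue_cube R d; apply: le_lt_trans.
apply: le_measure; rewrite ?inE//; first exact: measurable_punctured_ball.
move=> x /andP[_ x1] i; rewrite -ler_norml -sqrtr_sqr (le_trans _ x1)//.
by rewrite ler_wsqrtr// (bigD1 i)//= lerDl sumr_ge0// => j _; exact: sqr_ge0.
Qed.

HB.instance Definition _ := Measure_isFinite.Build _ _ _ cone_measure
  cone_finite.

(* The factor d makes this the (d-1)-dimensional area: the part of the unit
   ball over A has volume sigma(A) * \int_0^1 r^(d-1) dr = sigma(A) / d. It is
   a measure on R^d that is concentrated on the sphere. *)
Definition surface_measure : set (euclidean R d) -> \bar R :=
  mscale d%:R%:nng cone_measure.

HB.instance Definition _ := FiniteMeasure.on surface_measure.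

End surface_measure.

(* The library's L^p spaces only cover real-valued functions. *)
Section complex_L2.
Context dT (T : measurableType dT) (R : realType).
Variables (mu : {measure set T -> \bar R}) (D : set T).
Implicit Types f g : T -> R[i].

Definition complex_measurable f :=
  measurable_fun D (fun x => complex.Re (f x)) /\
  measurable_fun D (fun x => complex.Im (f x)).

Definition complex_integral f : R[i] :=
  Complex (\int[mu]_(x in D) complex.Re (f x))
          (\int[mu]_(x in D) complex.Im (f x)).

Definition sqr_L2norm f : \bar R :=
  (\int[mu]_(x in D) (Normc.normc (f x) ^+ 2)%:E)%E.

Definition in_L2 f := complex_measurable f /\ (sqr_L2norm f < +oo)%E.

Definition L2_inner f g : R[i] := complex_integral (fun x => f x * conjc (g x)).

(* Such an e exists only for n = dim H (as a subspace of L^2(D)). *)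
Definition orthonormal_basis (n : nat) (e : 'I_n -> T -> R[i])
    (H : set (T -> R[i])) :=
  [/\ forall k, H (e k),
      forall k l, L2_inner (e k) (e l) = (k == l)%:R &
      forall f, H f -> exists c : 'I_n -> R[i],
        f = (fun x => \sum_(k < n) c k * e k x) %[ae mu in D]].

End complex_L2.

Section spherical_harmonics.
Context (R : realType) (d : nat).
Local Notation sigma := (@surface_measure R d).
Local Notation S := (@sphere R d).

(* H_j as a subspace of L^2(sphere): functions equal sigma-a.e. on the sphere
   to a homogeneous harmonic polynomial of degree j. *)
Definition spherical_harmonics (j : nat) : set (euclidean R d -> R[i]) :=
  [set f | in_L2 sigma S f /\
    exists2 p, SolidHarmonic.solid_harmonic j p &
      f = (fun x => SolidHarmonic.eval p [tuple (tnth x i : R)%:C%C | i < d])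
        %[ae sigma in S]].

Local Notation kernel := (euclidean R d * euclidean R d -> R[i]).

Definition in_L2_kernel (K : kernel) := in_L2 (sigma \x sigma)%E (S `*` S) K.

Definition hermitian_kernel (K : kernel) :=
  K = (fun z => conjc (K (z.2, z.1))) %[ae (sigma \x sigma)%E in S `*` S].

Variable N : nat -> nat.
Variable Y : forall j, 'I_(N j) -> euclidean R d -> R[i].
Variable a : forall j j', 'I_(N j) -> 'I_(N j') -> R[i].

Definition kernel_partial_sum (n : nat) : kernel := fun z =>
  \sum_(j < n) \sum_(j' < n) \sum_(k < N j) \sum_(k' < N j')
    a k k' * Y k z.1 * conjc (Y k' z.2).

(* Convergence in L^2. For the orthonormal functions (x, y) |-> Y k x * conj
   (Y k' y), convergence of the square partial sums used here is equivalent to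
   unconditional convergence of the double series. *)
Definition kernel_expansion (K : kernel) :=
  sqr_L2norm (sigma \x sigma)%E (S `*` S)
    (fun z => K z - kernel_partial_sum n z) @[n --> \oo] --> 0%E.

End spherical_harmonics.

(* Main.v *)
(** Write T f = \int K(x, .) conj(f(x)) dx. The heart of the matter is that
    spherical harmonics of different degrees are orthogonal. Let L be the linear
    functional on polynomials whose value on a monomial is the product of the
    moments of exp(-x^2). Integration by parts gives L(d_i F) = 2 L(x_i F), hence
    for p, q solid harmonic of degrees j, l,
      2 j L(p q) = L(grad p . grad q) = 2 l L(p q)
    by Euler's identity, so that L(p q) = 0 when j <> l. Since exp(-|x|^2) is a
    product of one-variable functions, and since integrals of homogeneous
    functions against radial weights are proportional to each other, L is
    proportional to integration over the sphere in each positive degree.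

    If K_n is a partial sum of the expansion then T_n f -> T f in L^1: this is
    Tonelli's theorem and |K - K_n| |f| <= t |K - K_n|^2 + |f|^2 / t with t large.
    If the coefficients are diagonal in the degree, then T_n f is a fixed element
    of H_j for f in H_j and n > j. Conversely a(j,j',k,k') is the integral of
    T_n(Y_j^k) Y_j'^k' for large n, and that of T(Y_j^k) Y_j'^k' vanishes by
    orthogonality. *)

From HB Require Import structures.
From mathcomp Require Import all_boot all_order all_algebra.
Require Import Defs.
Set Implicit Arguments.
Unset Strict Implicit.
Unset Printing Implicit Defensive.
Import GRing.Theory Num.Theory.

(** * Gaussian moments of solid harmonics *)

Module HarmonicMoments.
From mathcomp Require Import bigenough ssrcomplements mpoly.
Import BigEnough.
Import Defs.SolidHarmonic.
Local Open Scope ring_scope.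

(** * Algebra of solid harmonics and their expansion in monomials *)

Section closure.
Context (F : comNzRingType) (d : nat).
Implicit Types p q : {mpoly F[d]}.

Lemma solid_harmonic0 j : solid_harmonic j (0 : {mpoly F[d]}).
Proof. by split; [exact: rpred0 | rewrite /laplacian big1// => i _; rewrite !linear0]. Qed.

Lemma solid_harmonic_scalar j c p q :
  solid_harmonic j p -> solid_harmonic j q -> solid_harmonic j (c *: p + q).
Proof.
move=> [hp lp] [hq lq]; split; first by rewrite rpredD ?rpredZ.
rewrite /laplacian (eq_bigr (fun i => c *: p^`M(i)^`M(i) + q^`M(i)^`M(i))).
  by rewrite big_split/= -scaler_sumr -/(laplacian _) lp scaler0 add0r.
by move=> i _; rewrite !linearP.
Qed.

Lemma eval0 (x : d.-tuple F) : eval 0 x = 0.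
Proof. exact: raddf0. Qed.

Lemma eval_scalar c p q x : eval (c *: p + q) x = c * eval p x + eval q x.
Proof. by rewrite /eval mevalD mevalZ. Qed.

(** Interface to the analytic part, which integrates polynomials monomial by monomial and sees only
    coefficients and exponent functions. *)
Lemma eval_monomials p : exists s : seq (F * {ffun 'I_d -> nat}),
  forall x, eval p x = \sum_(t <- s) t.1 * \prod_(i < d) tnth x i ^+ t.2 i.
Proof.
exists [seq (p@_m, [ffun i => (m : 'X_{1..d}) i]) | m <- msupp p] => x.
rewrite /eval mevalE [RHS]big_map; apply: eq_bigr => m _; congr (_ * _).
by apply: eq_bigr => i _; rewrite ffunE.
Qed.

End closure.

(** Applying [f] to the coefficients commutes with differentiation and does not enlarge the support.
    For complex conjugation this shows that the spherical harmonics of a given degree are closed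
    under conjugation. *)
Lemma solid_harmonic_map (F G : comNzRingType) (f : {rmorphism F -> G}) d j
    (p : {mpoly F[d]}) : solid_harmonic j p ->
  exists2 q : {mpoly G[d]}, solid_harmonic j q &
    forall x : d.-tuple F, f (eval p x) = eval q [tuple f (tnth x i) | i < d].
Proof.
move=> [hp lp]; exists (map_mpoly f p).
  have dE i (r : {mpoly F[d]}) : (map_mpoly f r)^`M(i) = map_mpoly f r^`M(i).
    apply/mpolyP => m; rewrite mcoeff_deriv !mcoeff_map_mpoly mcoeff_deriv.
    by rewrite /= raddfMn.
  split.
    apply/dhomogP => m; rewrite mcoeff_msupp mcoeff_map_mpoly => mp.
    apply: (dhomog_mf hp); rewrite mcoeff_msupp; apply: contraNneq mp => ->.
    by rewrite /= raddf0.
  rewrite /laplacian; under eq_bigr do rewrite !dE.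
  by rewrite -raddf_sum -/(laplacian p) lp raddf0.
move=> x; rewrite /eval [p]mpolyE (raddf_sum (map_mpoly f)).
rewrite (raddf_sum (@meval d F (tnth x))) (raddf_sum f).
rewrite (raddf_sum (@meval d G _)); apply: eq_bigr => m _ /=.
rewrite map_mpolyZ map_mpolyX !mevalZ !mevalX rmorphM rmorph_prod; congr (_ * _).
by apply: eq_bigr => i _; rewrite rmorphXn tnth_mktuple.
Qed.

(** * The moment functional and the orthogonality of different degrees *)

Section moment.
Context (F : numDomainType) (d : nat) (M : nat -> F).
Implicit Types p q : {mpoly F[d]}.
Hypothesis M1 : M 1 = 0.
Hypothesis MS : forall n, 2 * M n.+2 = n.+1%:R * M n.

(** The functional L. When [M n] is the n-th moment of exp(-x^2), this is integration against
    exp(-|x|^2). The algebra assumes only the recursion of these moments, which leaves [M 0]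
    free. *)
Definition moment p : F :=
  \sum_(m <- msupp p) p@_m * \prod_(i < d) M (m i).

(** The index set of monomials of bounded degree is common to several polynomials, so linearity can
    be checked term by term. *)
Lemma momentwE p k : (msize p <= k)%N ->
  moment p = \sum_(m : 'X_{1..d < k}) p@_m * \prod_(i < d) M (m i).
Proof.
pose I : subFinType _ := 'X_{1..d < k}.
move=> le_pk; rewrite /moment (big_mksub I)/=; first last.
  by move=> x /msize_mdeg_lt/leq_trans/(_ le_pk).
  by rewrite msupp_uniq.
by rewrite big_rmcond//= => j /memN_msupp_eq0 ->; rewrite mul0r.
Qed.

Lemma moment_is_scalar : scalar moment.
Proof.
move=> c p q; pose_big_enough k.
  rewrite !(@momentwE _ k)//= mulr_sumr -big_split/=; apply: eq_bigr => m _.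
  by rewrite mcoeffD mcoeffZ mulrDl mulrA.
by close.
Qed.

HB.instance Definition _ := GRing.isLinear.Build F {mpoly F[d]} F *%R
  moment moment_is_scalar.

Lemma momentX m : moment 'X_[m] = \prod_(i < d) M (m i).
Proof. by rewrite /moment msuppX big_seq1 mcoeffX eqxx mul1r. Qed.

(* Integration by parts against the weight exp (- x ^ 2). *)
Lemma moment_deriv i p : moment p^`M(i) = 2 * moment ('X_i * p).
Proof.
rewrite [p]mpolyE (raddf_sum (mderiv i)) (mulr_sumr _ _ _ 'X_i).
rewrite !(raddf_sum moment) mulr_sumr; apply: eq_bigr => m _ /=.
rewrite linearZ/= linearZ/= -scalerAr linearZ/= mulrCA; congr (_ * _).
rewrite mderivX linearZ/= -mpolyXD !momentX (bigD1 i)//=.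
rewrite [in RHS](bigD1 i)//= mnmDE mnmBE mnm1E eqxx add1n.
have E (k : 'X_{1..d}) : (forall l, l != i -> k l = m l) ->
    \prod_(l < d | l != i) M (k l) = \prod_(l < d | l != i) M (m l).
  by move=> km; apply: eq_bigr => l /km ->.
rewrite !E; first last.
- by move=> l /negPf li; rewrite mnmBE mnm1E eq_sym li subn0.
- by move=> l /negPf li; rewrite mnmDE mnm1E eq_sym li.
(* Only the factor of index [i] is left. For exponent 0 the derivative vanishes and the other side
   contains [M 1]; otherwise this is the recursion [MS]. *)
rewrite !mulrA; congr (_ * _); case: (m i) => [|n].
  by rewrite M1 mul0r mulr0.
by rewrite MS subn1.
Qed.

(** Each monomial is an eigenvector of x_i d_i, with its i-th exponent as eigenvalue, and the
    exponents add up to [j]. *)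
Lemma mpoly_euler j p : p \is j.-homog ->
  \sum_(i < d) 'X_i * p^`M(i) = j%:R *: p.
Proof.
move=> /dhomogP hp; rewrite {2}[p]mpolyE scaler_sumr.
rewrite (eq_bigr (fun i => \sum_(m <- msupp p) 'X_i * (p@_m *: 'X_[m])^`M(i)));
  last first.
  by move=> i _; rewrite {1}[p]mpolyE (raddf_sum (mderiv i)) mulr_sumr.
rewrite exchange_big/= !big_seq; apply: eq_bigr => m /hp mj.
rewrite -mj /= mdegE natr_sum scaler_suml; apply: eq_bigr => i _.
rewrite linearZ/= mderivX -!scalerAr [RHS]scalerA [in RHS]mulrC -[RHS]scalerA; congr (_ *: _).
(* For exponent 0 the subtraction in the derivative is truncated and multiplication by ['X_i] does
   not undo it; the coefficient 0 takes care of this case. *)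
case E: (m i) => [|n]; first by rewrite !mulr0n !scale0r.
congr (_ *: _); rewrite -mpolyXD addmC submK//.
by apply/mnm_lepP => l; rewrite mnm1E; case: eqVneq => // <-; rewrite E.
Qed.

(* Green's formula: [moment] of [Delta p * q + grad p . grad q] is
   [2 * moment (x . grad p * q)], and the gradient term is symmetric. *)
Lemma moment_solid_harmonic_mul j l p q : j != l ->
  solid_harmonic j p -> solid_harmonic l q -> moment (p * q) = 0.
Proof.
move=> jl.
have green k (r s : {mpoly F[d]}) : solid_harmonic k r ->
    moment (\sum_(i < d) r^`M(i) * s^`M(i)) = 2 * (k%:R * moment (r * s)).
  move=> [hr lr].
  have : moment (\sum_(i < d) (r^`M(i) * s)^`M(i)) =
         2 * moment (\sum_(i < d) 'X_i * (r^`M(i) * s)).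
    by rewrite !raddf_sum mulr_sumr; apply: eq_bigr => i _; exact: moment_deriv.
  under [in RHS]eq_bigr do rewrite mulrA.
  rewrite -mulr_suml (mpoly_euler hr) -scalerAl linearZ/= => <-; congr moment.
  under [in RHS]eq_bigr do rewrite mderivM.
  by rewrite big_split/= -mulr_suml -/(laplacian r) lr mul0r add0r.
move=> hp hq; have := green _ _ p hq; under eq_bigr do rewrite mulrC.
rewrite (green _ _ q hp) (mulrC q) => /eqP; rewrite -subr_eq0 -mulrBr -mulrBl !mulf_eq0.
by rewrite pnatr_eq0/= subr_eq0 eqr_nat (negPf jl) => /eqP.
Qed.

(** Orthogonality in terms of coefficients and exponents only. All monomials have the same total
    degree, so a single constant will convert their Gaussian moments into integrals over the
    sphere. *)
Lemma solid_harmonic_mul j l p q : j != l ->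
  solid_harmonic j p -> solid_harmonic l q ->
  exists s : seq (F * {ffun 'I_d -> nat}),
    [/\ forall x, eval p x * eval q x =
          \sum_(t <- s) t.1 * \prod_(i < d) tnth x i ^+ t.2 i,
        forall t, t \in s -> (\sum_(i < d) t.2 i = j + l)%N &
        \sum_(t <- s) t.1 * \prod_(i < d) M (t.2 i) = 0].
Proof.
move=> jl hp hq.
exists [seq ((p * q)@_m, [ffun i => (m : 'X_{1..d}) i]) | m <- msupp (p * q)].
split => [x|t /mapP[m mpq ->]/=|].
- rewrite /eval -mevalM mevalE [RHS]big_map.
  apply: eq_bigr => m _ /=; congr (_ * _).
  by apply: eq_bigr => i _; rewrite ffunE.
- rewrite -(dhomog_mf (dhomogM hp.1 hq.1) mpq) /= mdegE.
  by apply: eq_bigr => i _; rewrite ffunE.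
- rewrite -[RHS](moment_solid_harmonic_mul jl hp hq) /moment big_map.
  apply: eq_bigr => m _; congr (_ * _).
  by apply: eq_bigr => i _; rewrite ffunE.
Qed.

End moment.

End HarmonicMoments.

From mathcomp Require Import all_classical all_reals all_analysis.
From mathcomp Require Import measurable_realfun complex ring lra.
Import Order.TTheory GRing.Theory Num.Theory.
Import numFieldNormedType.Exports.
Local Open Scope classical_set_scope.
Local Open Scope ring_scope.

(** * Moments of the Gaussian weight *)

Section gaussian_moments.
Context {R : realType}.
Local Notation mu := (@lebesgue_measure R).
Local Notation gauss := (@gauss_fun R).
Implicit Types (x : R) (n : nat).

(** Half of the exponent of exp(-x^2) absorbs the power of [x]; the other half stays available for
    integrability. *)
Lemma exprn_gauss_bounded n :
  exists2 C : R, 0 < C & forall x, `|x ^+ n| * expR (- (x ^+ 2 / 2)) <= C.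
Proof.
(* With y = x^2 / 2, the constant comes from |x|^n <= 1 + x^(2(n+1)) = 1 + 2^(n+1) y^(n+1) and
   y^(n+1) <= (n+1)! exp(y). *)
exists (1 + 2 ^+ n.+1 * n.+1`!%:R); first by rewrite ltr_pwDl// mulr_ge0.
move=> x; rewrite expRN ler_pdivrMr ?expR_gt0// normrX.
set y := x ^+ 2 / 2; have y0 : 0 <= y by rewrite divr_ge0// sqr_ge0.
have ey : y ^+ n.+1 <= n.+1`!%:R * expR y.
  rewrite mulrC -ler_pdivrMr ?ltr0n ?fact_gt0//.
  by rewrite (le_trans _ (expR_ge1Dxn n y0))// lerDr.
apply: (@le_trans _ _ (1 + `|x| ^+ (2 * n.+1))).
  have [x1|x1] := leP `|x| 1.
    by rewrite (@le_trans _ _ 1)// ?exprn_ile1// lerDl exprn_ge0.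
  rewrite (@le_trans _ _ (`|x| ^+ (2 * n.+1)))// ?lerDr//.
  by apply: ler_weXn2l; [exact: ltW|rewrite mul2n -addnn addnS leqW// leqW// leq_addr].
rewrite mulrDl mul1r lerD//; first by rewrite -[leLHS]expR0 ler_expR.
rewrite exprM -normrX ger0_norm ?sqr_ge0// -mulrA.
have -> : x ^+ 2 = 2 * y by rewrite mulrC divfK.
by rewrite exprMn ler_wpM2l// exprn_ge0.
Qed.

Lemma continuous_exprn_gauss n : continuous (fun x => x ^+ n * gauss x).
Proof.
by move=> x; apply: cvgM; [exact: exprn_continuous|exact: continuous_gauss_fun].
Qed.

(** Domination by a multiple of the standard normal density, whose exponent -x^2 / 2 is the half
    left over by [exprn_gauss_bounded]. *)
Lemma integrable_exprn_gauss n :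
  mu.-integrable setT (fun x => (x ^+ n * gauss x)%:E).
Proof.
have [C C0 Cle] := exprn_gauss_bounded n.
have oneN0 : (1 : R) != 0 := oner_neq0 R.
have := @integrable_normal_pdf R 0 1.
move=> /(integrableZl measurableT (C / normal_peak 1)).
apply: le_integrable => //.
  apply/measurable_EFinP; apply: continuous_measurable_fun.
  exact: continuous_exprn_gauss.
move=> x _ /=; rewrite lee_fin normal_pdfE//=.
rewrite mulrA divfK ?gt_eqF ?normal_peak_gt0// /normal_fun subr0 expr1n.
rewrite [leRHS]ger0_norm ?mulr_ge0 ?expR_ge0// ?(ltW C0)//.
have -> : x ^+ n * gauss x = x ^+ n * expR (- (x ^+ 2 / 2)) * expR (- x ^+ 2 / 2).
  by rewrite -mulrA -expRD mulNr -opprD -splitr.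
rewrite normrM (ger0_norm (expR_ge0 (_ / 2))) ler_wpM2r ?expR_ge0//.
by rewrite normrM [`|expR _|]ger0_norm ?expR_ge0.
Qed.

(** Bounding one more power of [x] leaves a decay of order 1/k. The sign [s] covers both ends of the
    line. *)
Lemma cvg_exprn_gauss n (s : R) : `|s| = 1 ->
  ((s * k%:R) ^+ n * gauss (s * k%:R) @[k --> \oo] --> (0 : R)).
Proof.
move=> s1; have [C C0 Cle] := exprn_gauss_bounded n.+1.
apply/norm_cvg0P; apply: (@squeeze_cvgr _ _ _ _ (cst 0) (fun k => C * k%:R^-1)).
- near=> k; rewrite normr_ge0/=.
  have k0 : 0 < k%:R :> R by rewrite ltr0n; near: k; exact: nbhs_infty_gt.
  rewrite ler_pdivlMr// normrM (ger0_norm (gauss_fun_ge0 _)).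
  apply: le_trans (Cle (s * k%:R)); rewrite exprSr normrM mulrAC.
  rewrite (normrM s) s1 mul1r (ger0_norm (ltW k0)) ler_wpM2l ?mulr_ge0 ?(ltW k0)//.
  by rewrite /gauss_fun ler_expR lerN2 ler_pdivrMr// ler_peMr ?sqr_ge0// ler1n.
- exact: cvg_cst.
- rewrite -[X in _ --> X](mulr0 C); apply: cvgMr.
  apply/gtr0_cvgV0; last exact: cvgr_idn.
  by near=> k; rewrite ltr0n; near: k; exact: nbhs_infty_gt.
Unshelve. all: by end_near. Qed.

(** The fundamental theorem of calculus on growing symmetric intervals, followed by dominated
    convergence with |f| as the dominating function. *)
Lemma integral_derive_eq0 (f F : R -> R) :
  mu.-integrable setT (EFin \o f) -> continuous f ->
  (forall x, is_derive x 1 F (f x)) ->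
  (forall s : R, `|s| = 1 -> F (s * k%:R) @[k --> \oo] --> (0 : R)) ->
  (\int[mu]_x (f x)%:E = 0)%E.
Proof.
move=> intf cf dF F0.
(* The endpoints use [k.+1] so that no interval is degenerate. *)
pose I k : set R := [set` `[- 1 * k.+1%:R, 1 * k.+1%:R] ].
have mI k : measurable (I k) by exact: measurable_itv.
have mf : measurable_fun setT f by exact: continuous_measurable_fun.
pose f_ k : R -> \bar R := (EFin \o f) \_ (I k).
have mf_ k : measurable_fun setT (f_ k).
  by apply/(measurable_restrictT _ _).1 => //; exact/measurable_EFinP/measurable_funTS.
have ff : {ae mu, forall x, setT x -> f_ ^~ x @ \oo --> (f x)%:E}.
  apply/aeW => x _; apply: cvg_near_cst; near=> k.
  rewrite /f_ patchE ifT// inE /I/= in_itv/= mulN1r mul1r -ler_norml.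
  rewrite (@le_trans _ _ k%:R)// ?ler_nat//; near: k.
  exact: nbhs_infty_ger.
have fle : {ae mu, forall x n, setT x -> (`|f_ n x| <= `|(f x)%:E|)%E}.
  by apply/aeW => x k _; rewrite /f_ patchE; case: ifP => //= _; rewrite normr0 lee_fin.
have [_ _] := @dominated_convergence _ (measurableTypeR R) R mu setT measurableT f_
  (EFin \o f) _ mf_ ((measurable_EFinP _ _).2 mf) ff (integrable_abse intf) fle.
suff H : (\int[mu]_x f_ n x)%E @[n --> \oo] --> 0%E.
  by move=> /cvg_lim <-//; apply/cvg_lim.
have -> : (fun n => \int[mu]_x f_ n x)%E =
    (fun n => (F (1 * n.+1%:R) - F (- 1 * n.+1%:R))%:E).
  apply/funext => n; rewrite -integral_mkcond (@continuous_FTC2 _ _ F)//.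
  - by rewrite mulN1r mul1r gtrN.
  - exact: continuous_subspaceT.
  - have cF x : {for x, continuous F}.
      by apply: differentiable_continuous; apply/derivable1_diffP; have [] := dF x.
    split; first by move=> x _; have [] := dF x.
    + by apply: cvg_at_right_filter; exact: cF.
    + by apply: cvg_at_left_filter; exact: cF.
  - by move=> x _; rewrite derive1E; have [] := dF x.
apply: cvg_EFin; first exact: nearW.
rewrite -[X in _ --> X](subr0 (0 : R)).
have Fs s : `|s| = 1 -> F (s * n.+1%:R) @[n --> \oo] --> (0 : R).
  by move=> /F0; rewrite -cvg_shiftS.
by apply: cvgB; apply: Fs; rewrite ?normrN normr1.
Unshelve. all: by end_near. Qed.

Definition gauss_moment n : R := \int[mu]_x (x ^+ n * gauss x).

(** The derivative n x^(n-1) exp(-x^2) - 2 x^(n+1) exp(-x^2) of x^n exp(-x^2) has integral 0. At n =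
    0 the truncated predecessor is multiplied by 0, and the first moment is seen to vanish. *)
Lemma gauss_momentS n : 2 * gauss_moment n.+1 = n%:R * gauss_moment n.-1.
Proof.
have int k c : mu.-integrable setT (EFin \o (fun x => c * (x ^+ k * gauss x))).
  apply: eq_integrable (integrableZl measurableT c (integrable_exprn_gauss k)) => //.
pose f x := n%:R * (x ^+ n.-1 * gauss x) - 2 * (x ^+ n.+1 * gauss x).
have : (\int[mu]_x (f x)%:E = 0)%E.
  apply: (@integral_derive_eq0 _ (fun x => x ^+ n * gauss x)).
  - apply: eq_integrable (integrableB measurableT (int n.-1 n%:R) (int n.+1 2)) => //.
  - move=> x; apply: cvgB; apply: cvgM; first [exact: cvg_cst|exact: continuous_exprn_gauss].
  - move=> x; have dX := is_deriveX n (is_derive_id x (1 : R)).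
    have dN := is_deriveN (is_deriveX 2 (is_derive_id x (1 : R))).
    have := is_deriveM dX (is_derive1_comp (is_derive_expR _) dN).
    rewrite !fctE/= => d; apply: is_derive_eq d _.
    have E (u v e y m : R) :
        u * (e * - (2 * y * 1)) + e * (m * v * 1) = m * (v * e) - 2 * (y * u * e).
      by ring.
    by rewrite /GRing.scale/= /f /gauss_fun [x ^+ n.+1]exprS; exact: E.
  - by move=> s s1; exact: cvg_exprn_gauss.
rewrite /f => /(congr1 fine).
rewrite -[LHS]/(\int[mu]_x (n%:R * (x ^+ n.-1 * gauss x) - 2 * (x ^+ n.+1 * gauss x))).
rewrite RintegralB// !RintegralZl//; [|exact: integrable_exprn_gauss..].
by move=> /eqP; rewrite subr_eq0 => /eqP.
Qed.

End gaussian_moments.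
(** * Polar integration *)

Section euclidean_scaling.
Context {R : realType}.
Local Notation mu := (@lebesgue_measure R).
Local Notation leb := (euclidean_lebesgue R).
Local Open Scope ereal_scope.

(** Uniqueness of Lebesgue measure: [t] times its image under x |-> t x gives every half-open
    interval its length. *)
Lemma ge0_integral_lebesgue_scale (t : R) (f : measurableTypeR R -> \bar R) :
  (0 < t)%R -> measurable_fun setT f -> (forall x, 0 <= f x) ->
  t%:E * \int[mu]_x f (t * x)%R = \int[mu]_x f x.
Proof.
move=> t0 mf f0.
have mt : measurable_fun setT (fun x : measurableTypeR R => (t * x)%R : measurableTypeR R).
  by apply: (@measurable_funM _ _ R); [exact: measurable_cst|exact: measurable_id].
pose phi (x : measurableTypeR R) : measurableTypeR R := (t * x)%R.
pose m := mscale (NngNum (ltW t0))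
  (measure_function_pushforward__canonical__measure_function_Measure mu mt).
have mE A : measurable A -> mu A = m A.
  apply: lebesgue_measure_unique => _ [[a b] _ <-]/=.
  rewrite /m /mscale/= /pushforward.
  have -> : phi @^-1` `]a, b] = `](a / t)%R, (b / t)%R]%classic.
    apply/seteqP; split => x /=; rewrite !in_itv/=;
      by rewrite /phi ltr_pdivrMr// ler_pdivlMr// (mulrC t).
  rewrite !lebesgue_measure_itv/= !lte_fin ltr_pM2r ?invr_gt0//.
  case: ifP => _; last by rewrite mule0.
  by rewrite -!EFinD -EFinM -mulrBl mulrC divfK ?gt_eqF.
rewrite [RHS](@eq_measure_integral _ _ _ _ m)//; last by move=> A mA _; exact: mE.
rewrite [RHS]ge0_integral_mscale//; congr (_ * _).
apply/esym; rewrite -[RHS]/(\int[mu]_(x in phi @^-1` setT) (f \o phi) x).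
by rewrite -ge0_integral_pushforward.
Qed.

Lemma ge0_integral_euclideanS n (f : euclidean R n.+1 -> \bar R) :
  measurable_fun setT f -> (forall x, 0 <= f x) ->
  \int[leb n.+1]_x f x = \int[mu]_x \int[leb n]_y f (cons_euclidean (x, y)).
Proof.
move=> mf f0; rewrite /= /lebesgue_measure_step ge0_integral_pushforward//.
rewrite preimage_setT (fubini_tonelli1 (m1 := mu) (m2 := leb n))//.
  by apply: measurableT_comp => //; exact: measurable_cons_euclidean.
by move=> x; exact: f0.
Qed.

Definition scale_euclidean n (t : R) (x : euclidean R n) : euclidean R n :=
  [tuple (t * tnth x i : R)%R | i < n].

Lemma measurable_scale_euclidean n t :
  measurable_fun setT (@scale_euclidean n t).
Proof.
apply/measurable_fun_tnthP => i.
rewrite (_ : _ \o _ = fun x : euclidean R n => (t * tnth x i : R)%R).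
  by apply: (@measurable_funM _ _ R); [exact: measurable_cst|exact: measurable_tnth].
by apply/funext => x /=; rewrite tnth_mktuple.
Qed.

Lemma scale_cons_euclidean n t (x : measurableTypeR R) (y : euclidean R n) :
  scale_euclidean t (cons_euclidean (x, y)) =
  cons_euclidean ((t * x)%R : measurableTypeR R, scale_euclidean t y).
Proof.
apply: eq_from_tnth => i; rewrite tnth_mktuple.
by have [j ->|->] := unliftP ord0 i; rewrite ?tnthS ?tnth0// tnth_mktuple.
Qed.

(** Induction on the dimension through Tonelli's theorem, each coordinate contributing one factor
    [t]. *)
Lemma ge0_integral_euclidean_scale n (t : R) (f : euclidean R n -> \bar R) :
  (0 < t)%R -> measurable_fun setT f -> (forall x, 0 <= f x) ->
  (t ^+ n)%:E * \int[leb n]_x f (scale_euclidean t x) = \int[leb n]_x f x.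
Proof.
move=> t0; elim: n f => [|n IH] f mf f0.
  rewrite expr0 mul1e; apply: eq_integral => x _; congr f.
  by apply: eq_from_tnth => -[].
have mfs : measurable_fun setT (fun x => f (scale_euclidean t x)).
  by apply: measurableT_comp => //; exact: measurable_scale_euclidean.
rewrite !ge0_integral_euclideanS//.
have mfc (x : measurableTypeR R) : measurable_fun setT (fun y => f (cons_euclidean (x, y))).
  apply: measurableT_comp => //; apply: measurableT_comp.
    exact: measurable_cons_euclidean.
  exact: pair1_measurable.
pose F (x : measurableTypeR R) := \int[leb n]_y f (cons_euclidean (x, y)).
have mF : measurable_fun setT F.
  apply: (measurable_fun_fubini_tonelli_F (m2 := leb n) (f \o @cons_euclidean R n)).
    by apply: measurableT_comp => //; exact: measurable_cons_euclidean.
  by move=> x; exact: f0.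
have F0 x : 0 <= F x by exact: integral_ge0.
rewrite -[RHS](ge0_integral_lebesgue_scale t0 mF F0) exprS EFinM -muleA.
congr (_ * _); rewrite -ge0_integralZl//.
- apply: eq_integral => x _; rewrite /F -(IH _ (mfc (t * x)%R))//.
  by congr (_ * _); apply: eq_integral => y _; rewrite scale_cons_euclidean.
- apply: (measurable_fun_fubini_tonelli_F (m2 := leb n)
    (fun z => f (scale_euclidean t (cons_euclidean z)))) => //.
  by apply: (measurableT_comp mfs); exact: measurable_cons_euclidean.
- by move=> x _; exact: integral_ge0.
- by rewrite lee_fin exprn_ge0// ltW.
Qed.

End euclidean_scaling.

(** * Integrals of products of one-variable functions *)

Section euclidean_product.
Context {R : realType}.
Local Notation mu := (@lebesgue_measure R).
Local Notation leb := (euclidean_lebesgue R).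
Local Open Scope ereal_scope.

Lemma integrable_prod_meas d1 d2 (T1 : measurableType d1)
    (T2 : measurableType d2) (m1 : {sigma_finite_measure set T1 -> \bar R})
    (m2 : {sigma_finite_measure set T2 -> \bar R}) (f : T1 -> R) (g : T2 -> R) :
  m1.-integrable setT (EFin \o f) -> m2.-integrable setT (EFin \o g) ->
  (m1 \x m2).-integrable setT (fun z => (f z.1 * g z.2)%:E).
Proof.
move=> intf intg.
have /measurable_EFinP mf := measurable_int _ intf.
have /measurable_EFinP mg := measurable_int _ intg.
apply/integrable12ltyP.
  apply/measurable_EFinP/measurable_funM; exact: measurableT_comp.
under eq_integral => x _.
  under eq_integral do rewrite /= normrM EFinM.
  rewrite ge0_integralZl//; last exact/measurable_EFinP/measurableT_comp.
  over.
rewrite ge0_integralZr//.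
- have /integrableP[_ foo] := intf; have /integrableP[_ goo] := intg.
  by rewrite lte_mul_pinfty ?integral_ge0// ge0_fin_numE ?integral_ge0.
- exact/measurable_EFinP/measurableT_comp.
- exact: integral_ge0.
Qed.

Lemma integral_prod_meas d1 d2 (T1 : measurableType d1)
    (T2 : measurableType d2) (m1 : {sigma_finite_measure set T1 -> \bar R})
    (m2 : {sigma_finite_measure set T2 -> \bar R}) (f : T1 -> R) (g : T2 -> R) :
  m1.-integrable setT (EFin \o f) -> m2.-integrable setT (EFin \o g) ->
  \int[m1 \x m2]_z (f z.1 * g z.2)%:E =
  (\int[m1]_x (f x)%:E) * \int[m2]_y (g y)%:E.
Proof.
move=> intf intg; rewrite -integral12_prod_meas1; last exact: integrable_prod_meas.
rewrite /fubini_F/=.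
have -> : (fun x => \int[m2]_y (f x * g y)%:E) =
    (fun x => (f x)%:E * \int[m2]_y (g y)%:E).
  by apply/funext => x; under eq_integral do rewrite EFinM; rewrite integralZl.
by rewrite -(fineK (integrable_fin_num _ intg))// integralZr.
Qed.

(** Induction on the dimension by Fubini's theorem, starting from the Dirac mass at the empty tuple.
    It will factor the Gaussian integral of a monomial. *)
Lemma euclidean_product_integral n (f : 'I_n -> measurableTypeR R -> R) :
  (forall i, mu.-integrable setT (EFin \o f i)) ->
  (leb n).-integrable setT (fun x => (\prod_(i < n) f i (tnth x i))%:E) /\
  \int[leb n]_x (\prod_(i < n) f i (tnth x i))%:E =
  (\prod_(i < n) \int[mu]_x f i x)%:E.
Proof.
elim: n f => [|n IH] f intf.
  have -> : (fun x => (\prod_(i < 0) f i (tnth x i))%:E) = EFin \o cst 1%R.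
    by apply/funext => x; rewrite big_ord0.
  rewrite big_ord0 /=; split.
    by apply: finite_measure_integrable_cst.
  rewrite integral_dirac//; first by rewrite [\d__ _]diracT mul1e.
  exact/measurable_EFinP.
have [intg Eg] := IH (fun i => f (lift ord0 i)) (fun i => intf (lift ord0 i)).
set g := fun y : euclidean R n => (\prod_(i < n) f (lift ord0 i) (tnth y i))%R.
pose h (x : euclidean R n.+1) := (\prod_(i < n.+1) f i (tnth x i))%R.
have hE : h \o @cons_euclidean R n = fun z => (f ord0 z.1 * g z.2)%R.
  apply/funext => z; rewrite /h /= big_ord_recl tnth0; congr (_ * _)%R.
  by apply: eq_bigr => i _; rewrite tnthS.
have mh : measurable_fun setT h.
  apply: measurable_prod => i _.
  have /measurable_EFinP mf := measurable_int _ (intf i).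
  by apply: measurableT_comp => //; exact: measurable_tnth.
have mc := @measurable_cons_euclidean R n.
have int_hc : (mu \x leb n).-integrable (@cons_euclidean R n @^-1` setT)
    ((EFin \o h) \o @cons_euclidean R n).
  by rewrite -compA hE; exact: integrable_prod_meas.
have mEh := (measurable_EFinP _ _).2 mh.
split.
  exact: (integrable_pushforward mc mEh int_hc measurableT).
rewrite [LHS](integral_pushforward mc mEh int_hc measurableT) -compA hE integral_prod_meas//.
rewrite Eg big_ord_recl EFinM /Rintegral fineK//.
exact: (integrable_fin_num _ (intf ord0)).
Qed.

End euclidean_product.

(** * Layer cake formula for homogeneous functions against radial weights *)

Lemma measurable_bool_natr dT (T : measurableType dT) (R : realType) (D : set T)
    (b : T -> bool) : measurable_fun D b -> measurable_fun D (fun x => (b x)%:R : R).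
Proof. by move=> mb; apply: (measurableT_comp (f := fun c : bool => c%:R : R)). Qed.

Section layer_cake.
Context {R : realType} (d : nat).
Local Notation mu := (@lebesgue_measure R).
Local Notation leb := (euclidean_lebesgue R d).
Local Notation norm := (@euclidean_norm R d).
Local Open Scope ereal_scope.

Lemma euclidean_norm_ge0 (x : euclidean R d) : (0 <= norm x)%R.
Proof. exact: sqrtr_ge0. Qed.

Lemma euclidean_norm_scale t x :
  (0 <= t)%R -> norm (scale_euclidean t x) = (t * norm x)%R.
Proof.
move=> t0; rewrite /euclidean_norm.
under eq_bigr do rewrite tnth_mktuple exprMn.
by rewrite -mulr_sumr sqrtrM ?sqr_ge0// sqrtr_sqr ger0_norm.
Qed.

Variables (m : nat) (w : euclidean R d -> R) (g rho : R -> R).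
Hypothesis m_gt0 : (0 < m)%N.
Hypothesis mw : measurable_fun setT w.
Hypothesis w_ge0 : forall x, (0 <= w x)%R.
Hypothesis w_homog : forall t x, (0 < t)%R -> w (scale_euclidean t x) = (t ^+ m * w x)%R.
Hypothesis w_norm0 : forall x, norm x = 0%R -> w x = 0%R.
Hypothesis mg : measurable_fun setT g.
Hypothesis g_ge0 : forall r, (0 <= g r)%R.
Hypothesis mrho : measurable_fun setT rho.
Hypothesis rho_ge0 : forall t, (0 <= rho t)%R.
Hypothesis g_rho : forall r t, (0 < r)%R -> (0 < t)%R -> (t <= g r)%R = (r <= rho t)%R.

(** Dilation by [s] together with the homogeneity of [w]. For s = 0 the left side vanishes because
    [w] is 0 at norm 0, and the right side because [m] is positive. *)
Lemma ge0_integral_ball s : (0 <= s)%R ->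
  \int[leb]_x (w x * (norm x <= s)%R%:R)%:E =
  (s ^+ (d + m))%:E * \int[leb]_x (w x * (norm x <= 1)%R%:R)%:E.
Proof.
rewrite le_eqVlt => /predU1P[<-|s0].
  rewrite expr0n addn_eq0 [m == 0%N]gtn_eqF// andbF mul0e.
  rewrite integral0_eq// => x _.
  rewrite (_ : (norm x <= 0)%R = (norm x == 0%R)); last first.
    by rewrite eq_le euclidean_norm_ge0 andbT.
  by case: eqP => [/w_norm0->|_]; rewrite ?mul0r ?mulr0.
rewrite -(ge0_integral_euclidean_scale s0).
- rewrite exprD EFinM -muleA; congr (_ * _).
  rewrite -ge0_integralZl//; last 3 first.
  + apply/measurable_EFinP/measurable_funM => //.
    apply: measurable_bool_natr.
    by apply: measurable_fun_ler => //; exact: measurable_euclidean_norm.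
  + by move=> x _; rewrite lee_fin mulr_ge0.
  + by rewrite lee_fin exprn_ge0// ltW.
  apply: eq_integral => x _; rewrite w_homog// euclidean_norm_scale ?(ltW s0)//.
  by rewrite -EFinM mulrA ger_pMr.
- apply/measurable_EFinP/measurable_funM => //.
  apply: measurable_bool_natr.
  by apply: measurable_fun_ler => //; exact: measurable_euclidean_norm.
- by move=> x; rewrite lee_fin mulr_ge0.
Qed.

(** [g (norm x)] is the length of the interval from 0 to that value. After exchanging the integrals,
    [g_rho] identifies the superlevel set at height [t] with the ball of radius [rho t], and
    [ge0_integral_ball] applies. The first factor does not involve [w]. *)
Lemma ge0_integral_radial :
  \int[leb]_x (w x * g (norm x))%:E =
  \int[mu]_t (rho t ^+ (d + m) * (0 < t)%R%:R)%:E *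
  \int[leb]_x (w x * (norm x <= 1)%R%:R)%:E.
Proof.
pose F (z : euclidean R d * measurableTypeR R) :=
  (w z.1 * (0 < (z.2 : R) <= g (norm z.1))%R%:R)%:E.
have mF : measurable_fun setT F.
  apply/measurable_EFinP/measurable_funM; first exact: measurableT_comp.
  apply: measurable_bool_natr.
  have mt : measurable_fun setT
      (fun z : euclidean R d * measurableTypeR R => z.2 : R) by exact: measurable_snd.
  apply: measurable_and; first exact: measurable_fun_ltr.
  apply: measurable_fun_ler => //; apply: (measurableT_comp mg).
  by apply: (measurableT_comp (@measurable_euclidean_norm R d)).
have F0 z : 0 <= F z by rewrite lee_fin mulr_ge0.
transitivity (\int[leb]_x \int[mu]_t F (x, t)).
  apply: eq_integral => x _.
  transitivity ((w x)%:E * \int[mu]_t (\1_(`]0%R, g (norm x)]%classic : set R) t)%:E).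
    rewrite integral_indic// setIT /= lebesgue_measure_itv/= lte_fin.
    case: ltP => [_|g0]; first by rewrite -EFinB subr0 EFinM.
    by rewrite (@le_anti _ _ (g (norm x)) 0%R) ?g_ge0 ?g0// mulr0 mule0.
  rewrite -ge0_integralZl ?lee_fin//; last exact/measurable_EFinP/measurable_indic.
  by apply: eq_integral => t _; rewrite -EFinM indicE mem_setE/= in_itv.
rewrite fubini_tonelli//.
have -> : (fun t => \int[leb]_x F (x, t)) = (fun t : measurableTypeR R =>
    ((rho t ^+ (d + m) * (0 < t)%R%:R)%:E * \int[leb]_x (w x * (norm x <= 1)%R%:R)%:E)).
  apply/funext => t; have [t0|t0] := ltP 0%R (t : R); last first.
    rewrite mulr0 mul0e integral0_eq// => x _.
    by rewrite /F /= ltNge t0 mulr0.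
  rewrite mulr1 -ge0_integral_ball//; apply: eq_integral => x _; rewrite /F /= t0 /=.
  (* [g_rho] speaks of positive radii only; at norm 0 both integrands vanish with [w]. *)
  have [/w_norm0->|x0] := eqVneq (norm x) 0%R; first by rewrite !mul0r.
  by rewrite g_rho// lt_def x0 euclidean_norm_ge0.
rewrite ge0_integralZr//.
- apply/measurable_EFinP/measurable_funM; first exact: measurable_funX.
  apply: measurable_bool_natr.
  exact: measurable_fun_ltr.
- by move=> t _; rewrite lee_fin mulr_ge0// exprn_ge0.
- by apply: integral_ge0 => x _; rewrite lee_fin mulr_ge0.
Qed.

End layer_cake.
(** The part of [D] outside [B] is null for the restricted measure, and on subsets of [B] the two
    measures agree. *)
Lemma ge0_integral_mrestr dT (T : measurableType dT) (R : realType)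
    (m : {measure set T -> \bar R}) (B D : set T) (mB : measurable B)
    (f : T -> \bar R) : measurable D -> measurable_fun D f ->
  (forall x, D x -> 0 <= f x)%E ->
  (\int[mrestr m mB]_(x in D) f x = \int[m]_(x in D `&` B) f x)%E.
Proof.
move=> mD mf f0; rewrite (@ge0_negligible_integral _ _ _ (mrestr m mB) D (D `\` B))//.
- rewrite setDD; apply: eq_measure_integral => A mA AD.
  by rewrite /= /mrestr setIidl// => x /AD[].
- exact: measurableD.
- by rewrite /= /mrestr setDE -setIA setICl setI0 measure0.
Qed.

(** * Surface integrals against Gaussian integrals *)

Section sphere_integral.
Context {R : realType} (d : nat).
Local Notation mu := (@lebesgue_measure R).
Local Notation leb := (euclidean_lebesgue R d).
Local Notation norm := (@euclidean_norm R d).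
Local Notation sigma := (@surface_measure R d).
Local Notation S := (@sphere R d).
Local Notation B := (@punctured_ball R d).
Local Open Scope ereal_scope.

Lemma measurable_sphere : measurable S.
Proof.
rewrite (_ : S = norm @^-1` [set 1%R])// -[X in measurable X]setTI.
by apply: measurable_euclidean_norm.
Qed.

Lemma normalizeE x : normalize x = scale_euclidean (norm x)^-1 x.
Proof. by apply: eq_from_tnth => i; rewrite !tnth_mktuple mulrC. Qed.

(** The definition of surface measure by cones, carried over from sets to functions. *)
Lemma ge0_integral_surface (f : euclidean R d -> \bar R) :
  measurable_fun S f -> (forall x, S x -> 0 <= f x) ->
  \int[sigma]_(x in S) f x = d%:R%:E * \int[leb]_(x in B) f (normalize x).
Proof.
move=> mf f0; have mS := measurable_sphere.
have mn := @measurable_normalize R d.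
have mnS : measurable (@normalize R d @^-1` S).
  by rewrite -[X in measurable X]setTI; exact: mn.
rewrite ge0_integral_mscale//; congr (_ * _).
rewrite /cone_measure ge0_integral_pushforward//; last by move=> x /set_mem/f0.
rewrite ge0_integral_mrestr//.
(* Normalization maps the whole punctured ball to the sphere, so the preimage of the sphere imposes
   no further restriction. *)
- rewrite setIidr// => x /andP[x0 _].
  rewrite /= /sphere/= normalizeE euclidean_norm_scale ?invr_ge0 ?(ltW x0)//.
  by rewrite mulVf ?gt_eqF.
- apply: (measurable_comp mS) => //; last exact: measurable_funTS.
  by move=> _ [x ? <-].
- by move=> x; exact: f0.
Qed.

Lemma surface_sphere_fin_num : sigma S < +oo.
Proof.
by rewrite -ge0_fin_numE ?fin_num_measure//; exact: measurable_sphere.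
Qed.

(** The instance of [g_rho] for the Gaussian weight. For t > 1 the square root takes its default
    value 0 and both sides are false, as r > 0. *)
Lemma gauss_ge_sqrt (r t : R) : (0 < r)%R -> (0 < t)%R ->
  (t <= gauss_fun r)%R = (r <= Num.sqrt (- ln t))%R.
Proof.
move=> r0 t0; rewrite -[in LHS](lnK t0) ler_expR lerNr.
rewrite -[in RHS](ger0_norm (ltW r0)) -sqrtr_sqr.
have [lt0|lt0] := leP 0%R (- ln t)%R; first by rewrite ler_sqrt.
rewrite (ltr0_sqrtr lt0) leNgt [in RHS]leNgt sqrtr_gt0 exprn_gt0//.
by rewrite (lt_le_trans lt0)// sqr_ge0.
Qed.

(** The instance of [g_rho] for the weight r^(-m) cut off at 1. Against this weight a homogeneous
    [w] of degree [m] becomes w(x/|x|) on the punctured ball, the integrand of the surface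
    integral. *)
Lemma exprnV_ge_powR m (r t : R) : (0 < m)%N -> (0 < r)%R -> (0 < t)%R ->
  (t <= (r <= 1)%R%:R * r `^ - m%:R)%R = (r <= Num.min 1 (t `^ - m%:R^-1))%R.
Proof.
move=> m0 r0 t0.
rewrite -[(- m%:R^-1)%R]mulN1r powRrM powR_inv1 ?(ltW t0)// le_min.
case: (r <= 1)%R; last by rewrite mul0r lt_geF.
rewrite mul1r powRN (powR_mulrn m (ltW r0)) -lef_pV2 ?posrE ?invr_gt0 ?exprn_gt0// invrK.
apply/idP/idP => [rt|rt].
- have mV0 : (0 <= m%:R^-1 :> R)%R by rewrite invr_ge0.
  have nr : (r ^+ m)%R \in Num.nneg by rewrite nnegrE exprn_ge0// ltW.
  have nt : (t^-1)%R \in Num.nneg by rewrite nnegrE invr_ge0 ltW.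
  have := ge0_ler_powR mV0 nr nt rt.
  rewrite -(powR_mulrn m (ltW r0)) -powRrM mulfV ?powRr1 ?(ltW r0)//.
  by rewrite pnatr_eq0 -lt0n.
- rewrite -[leRHS]powRr1 ?invr_ge0 ?(ltW t0)//.
  rewrite -(@mulVf _ m%:R) ?pnatr_eq0 -?lt0n// powRrM powR_mulrn ?powR_ge0//.
  by rewrite lerXn2r ?nnegrE ?powR_ge0 ?(ltW r0).
Qed.

(* Layer cake reduces both sides to the integral of [w] over the unit ball,
   up to factors that may be infinite but do not depend on [w]. *)
Lemma surface_integral_gauss m : (0 < d)%N -> (0 < m)%N ->
  exists c : R, forall w : euclidean R d -> R,
    measurable_fun setT w -> (forall x, 0 <= w x <= norm x ^+ m)%R ->
    (forall t x, 0 < t -> w (scale_euclidean t x) = t ^+ m * w x)%R ->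
    \int[leb]_x (w x * gauss_fun (norm x))%:E < +oo ->
    \int[sigma]_(x in S) (w x)%:E =
    c%:E * \int[leb]_x (w x * gauss_fun (norm x))%:E.
Proof.
move=> d0 m0.
(* With [Q] the integral of [w] over the unit ball, the Gaussian integral will be [G * Q] and the
   surface integral [D * Q]; hence the ratio of [D] and [G] as constant. *)
pose I rho := \int[mu]_t (rho t ^+ (d + m) * (0 < t)%R%:R)%:E.
pose G := I (fun t => Num.sqrt (- ln t)).
pose D := d%:R%:E * I (fun t => Num.min 1%R (t `^ - m%:R^-1)%R).
have mnorm : measurable_fun setT norm := @measurable_euclidean_norm R d.
have msqrt : measurable_fun setT (@Num.sqrt R).
  by apply: continuous_measurable_fun; exact: sqrt_continuous.
exists (fine D / fine G)%R => w mw w01 w_homog woo.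
have w0 x : (0 <= w x)%R by have /andP[] := w01 x.
have w_norm0 x : norm x = 0%R -> w x = 0%R.
  by move=> x0; have := w01 x; rewrite x0 expr0n gtn_eqF//= -eq_le => /eqP.
pose Q := \int[leb]_x (w x * (norm x <= 1)%R%:R)%:E.
have Q0 : 0 <= Q by apply: integral_ge0 => x _; rewrite lee_fin mulr_ge0.
have GE : \int[leb]_x (w x * gauss_fun (norm x))%:E = G * Q.
  apply: ge0_integral_radial => //.
  - exact: measurable_gauss_fun.
  - by move=> r; exact: gauss_fun_ge0.
  - by apply: (measurableT_comp msqrt); apply: measurable_funN; exact: measurable_ln.
  - exact: gauss_ge_sqrt.
have DE : \int[sigma]_(x in S) (w x)%:E = D * Q.
  rewrite ge0_integral_surface; [|exact/measurable_funTS/measurable_EFinP|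
    by move=> x _; rewrite lee_fin].
  rewrite /D -muleA; congr (_ * _).
  rewrite -(@ge0_integral_radial _ _ m w (fun r => (r <= 1)%R%:R * r `^ - m%:R)%R)//.
  (* On the punctured ball homogeneity extracts the factor |x|^(-m) from [w (normalize x)];
     elsewhere [w] or the cut-off vanishes. *)
  - rewrite integral_mkcond; apply: eq_integral => x _; rewrite patchE.
    case: ifPn => [/set_mem/andP[x0 x1]|/negP xB].
      rewrite normalizeE w_homog ?invr_gt0// x1 mul1r powRN (powR_mulrn m (ltW x0)).
      by rewrite exprVn mulrC.
    have [/w_norm0->|x0] := eqVneq (norm x) 0%R; first by rewrite mul0r.
    case: (boolP (norm x <= 1)%R) => [x1|_]; last by rewrite mul0r mulr0.
    by case: xB; rewrite inE/= /punctured_ball/= x1 lt_def x0 euclidean_norm_ge0.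
  - apply: measurable_funM; first by apply: measurable_bool_natr; exact: measurable_fun_ler.
    exact: measurable_powR.
  - by move=> r; rewrite mulr_ge0// powR_ge0.
  - apply: measurable_minr => //; exact: measurable_powR.
  - by move=> t; rewrite le_min ler01 powR_ge0.
  - by move=> r t; exact: exprnV_ge_powR.
have Doo : D * Q < +oo.
  rewrite -DE (le_lt_trans _ surface_sphere_fin_num)// -[leRHS]mul1e.
  rewrite -(integral_cst _ measurable_sphere).
  apply: ge0_le_integral => //; first exact: measurable_sphere.
  - by move=> x _; rewrite lee_fin.
  - exact/measurable_funTS/measurable_EFinP.
  - by move=> x x1; rewrite lee_fin; have := w01 x; rewrite x1 expr1n => /andP[].
(* The Gaussian is at least exp(-1) on the unit ball, so [Q] is bounded by a multiple of [G * Q]. *)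
have GQ : G = 0 -> Q = 0.
  move=> G0; have : (expR (-1))%:E * Q <= 0.
    rewrite -(mul0e Q) -G0 -GE -ge0_integralZl//; last 2 first.
    + apply/measurable_EFinP/measurable_funM => //; apply: measurable_bool_natr.
      exact: measurable_fun_ler.
    + by move=> x _; rewrite lee_fin mulr_ge0.
    apply: ge0_le_integral => //.
    + by move=> x _; rewrite -EFinM lee_fin !mulr_ge0 ?expR_ge0.
    + apply: emeasurable_funM => //; apply/measurable_EFinP/measurable_funM => //.
      by apply: measurable_bool_natr; exact: measurable_fun_ler.
    + apply/measurable_EFinP/measurable_funM => //.
      by apply: measurableT_comp => //; exact: measurable_gauss_fun.
    + move=> x _; rewrite -EFinM lee_fin mulrCA ler_wpM2l//.
      case: (boolP (norm x <= 1)%R) => [x1|_]; last by rewrite mulr0 gauss_fun_ge0.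
      by rewrite mulr1 ler_expR lerN2 expr_le1 ?euclidean_norm_ge0.
  rewrite pmule_rle0 ?lte_fin ?expR_gt0// => Qle0.
  by apply/eqP; rewrite eq_le Qle0 Q0.
rewrite DE GE; rewrite GE in woo.
have [->|QN0] := eqVneq Q 0; first by rewrite !mule0.
have Qgt0 : 0 < Q by rewrite lt_def QN0.
(* Once [Q] is positive, the finiteness of both products forces [G] and [D] to be finite, and the
   quotient of their real values is meaningful. *)
have finN0 (A : \bar R) : 0 <= A -> A * Q < +oo -> A \is a fin_num.
  by case: A => [r| |]// _; rewrite gt0_mulye.
have I0 rho : (forall t, 0 <= rho t)%R -> 0 <= I rho.
  by move=> rho0; apply: integral_ge0 => t _; rewrite lee_fin mulr_ge0// exprn_ge0.
have Gfin : G \is a fin_num by apply: finN0 => //; apply: I0 => t; exact: sqrtr_ge0.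
have Dfin : D \is a fin_num.
  apply: finN0 => //; rewrite mule_ge0 ?lee_fin// I0// => t.
  by rewrite le_min ler01 powR_ge0.
have GN0 : fine G != 0%R by rewrite fine_eq0//; apply: contra_neq QN0 => /GQ.
by rewrite muleA -[in RHS](fineK Gfin) -EFinM divfK// fineK.
Qed.

End sphere_integral.
(** The positive and negative parts carry an explicit sign factor so that one argument can treat
    both. *)
Lemma integral_maxr0 dT (T : measurableType dT) (R : realType)
    (m : {measure set T -> \bar R}) (D : set T) (f : T -> R) :
  (\int[m]_(x in D) (f x)%:E =
   \int[m]_(x in D) (Num.max (1 * f x) 0)%:E -
   \int[m]_(x in D) (Num.max (-1 * f x) 0)%:E)%E.
Proof.
rewrite integralE; congr (_ - _)%E; apply: eq_integral => x _.
  by rewrite funeposE mul1r EFin_max.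
by rewrite funenegE mulN1r EFin_max.
Qed.

(** * Signed functions and monomials on the sphere *)

Section sphere_monomial.
Context {R : realType} (d : nat).
Local Notation mu := (@lebesgue_measure R).
Local Notation leb := (euclidean_lebesgue R d).
Local Notation norm := (@euclidean_norm R d).
Local Notation sigma := (@surface_measure R d).
Local Notation S := (@sphere R d).

(** Both parts of [Z] inherit its homogeneity and its bound, so the same [c] serves them.
    Integrability makes their Gaussian integrals finite, which allows [c] to be factored out of the
    difference. *)
Lemma signed_surface_integral_gauss m : (0 < d)%N -> (0 < m)%N ->
  exists c : R, forall Z : euclidean R d -> R,
    measurable_fun setT Z -> (forall x, `|Z x| <= norm x ^+ m) ->
    (forall t x, 0 < t -> Z (scale_euclidean t x) = t ^+ m * Z x) ->
    leb.-integrable setT (fun x => (Z x * gauss_fun (norm x))%:E) ->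
    (\int[sigma]_(x in S) (Z x)%:E =
     c%:E * \int[leb]_x (Z x * gauss_fun (norm x))%:E)%E.
Proof.
move=> d0 m0; have [c cE] := @surface_integral_gauss R d m d0 m0.
exists c => Z mZ Zle Z_homog intZ.
pose pos (s : R) x := Num.max (s * Z x) 0.
have posM s x : (pos s x * gauss_fun (norm x))%:E =
    maxe ((s * (Z x * gauss_fun (norm x)))%:E) 0%E.
  by rewrite -EFin_max /pos maxr_pMl ?gauss_fun_ge0// mul0r mulrA.
have pos_integral s : `|s| = 1 ->
    (\int[leb]_x (pos s x * gauss_fun (norm x))%:E < +oo)%E /\
    (\int[sigma]_(x in S) (pos s x)%:E =
     c%:E * \int[leb]_x (pos s x * gauss_fun (norm x))%:E)%E.
  move=> s1.
  have oo : (\int[leb]_x (pos s x * gauss_fun (norm x))%:E < +oo)%E.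
    have intp := integrable_funepos measurableT (integrableZl measurableT s intZ).
    rewrite (eq_integral _ _ (fun x _ => posM s x)).
    rewrite (eq_integral (fun x => s%:E * (Z x * gauss_fun (norm x))%:E)^\+)%E.
      exact: integrable_lty intp.
    by move=> x _; rewrite funeposE.
  split=> //; apply: cE => //.
  - by apply: measurable_maxr => //; exact: measurable_funM.
  - move=> x; rewrite le_max lexx orbT ge_max exprn_ge0 ?euclidean_norm_ge0// andbT.
    by rewrite (le_trans _ (Zle x))// (le_trans (ler_norm _))// normrM s1 mul1r.
  - move=> t x t0; rewrite /pos Z_homog// mulrCA maxr_pMr ?mulr0//.
    by rewrite exprn_ge0// ltW.
have [oo1 E1] := pos_integral 1 (normr1 _).
have [oo2 E2] := pos_integral (-1) (etrans (normrN _) (normr1 _)).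
have gaussM s x : Num.max (s * (Z x * gauss_fun (norm x))) 0 = pos s x * gauss_fun (norm x).
  by apply: EFin_inj; rewrite posM EFin_max.
rewrite integral_maxr0 E1 E2 [in RHS]integral_maxr0.
under [in RHS]eq_integral do rewrite gaussM.
under [X in (_ = _ * (_ - X))%E]eq_integral do rewrite gaussM.
have fin s : `|s| = 1 ->
    (\int[leb]_x (pos s x * gauss_fun (norm x))%:E)%E \is a fin_num.
  move=> s1; rewrite ge0_fin_numE; first by have [] := pos_integral s s1.
  by apply: integral_ge0 => x _; rewrite posM le_max lexx orbT.
rewrite -(fineK (fin 1 (normr1 _))) -(fineK (fin (-1) (etrans (normrN _) (normr1 _)))).
by rewrite -[in RHS]EFinB -!(EFinM c) -EFinB mulrBr.
Qed.

Lemma ler_norm_euclidean (x : euclidean R d) i : `|tnth x i : R| <= norm x.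
Proof.
rewrite -sqrtr_sqr ler_wsqrtr// (bigD1 i)//= lerDl sumr_ge0// => j _.
exact: sqr_ge0.
Qed.

Definition monomial (a : 'I_d -> nat) (x : euclidean R d) : R :=
  \prod_(i < d) (tnth x i : R) ^+ a i.

Lemma measurable_monomial a : measurable_fun setT (monomial a).
Proof.
apply: measurable_prod => i _; apply: measurable_funX.
exact: (@measurable_tnth _ (measurableTypeR R) d i).
Qed.

Lemma monomial_le a x : `|monomial a x| <= norm x ^+ (\sum_(i < d) a i)%N.
Proof.
rewrite normr_prod -prodrXr ler_prod// => i _; rewrite normr_ge0 normrX/=.
by rewrite lerXn2r ?nnegrE ?normr_ge0 ?euclidean_norm_ge0// ler_norm_euclidean.
Qed.

Lemma integrable_monomial a : sigma.-integrable S (fun x => (monomial a x)%:E).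
Proof.
have := finite_measure_integrable_cst sigma 1 (@measurable_sphere R d).
apply: le_integrable; first exact: measurable_sphere.
  by apply/measurable_EFinP/measurable_funTS; exact: measurable_monomial.
move=> x x1 /=; rewrite lee_fin normr1 (le_trans (monomial_le _ _))//.
by rewrite x1 expr1n.
Qed.

(** exp(-|x|^2) is a product over the coordinates, so the Gaussian integral of a monomial factors
    into moments. The constant depends on the degree and not on the exponents, hence passes through
    linear combinations of monomials of degree [m]. *)
Lemma surface_integral_monomial m : (0 < d)%N -> (0 < m)%N ->
  exists c : R, forall a : 'I_d -> nat, (\sum_(i < d) a i)%N = m ->
    \int[sigma]_(x in S) monomial a x = c * \prod_(i < d) gauss_moment (a i).
Proof.
move=> d0 m0; have [c cE] := signed_surface_integral_gauss d0 m0.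
exists c => a am.
have [inta Ea] := @euclidean_product_integral R d
  (fun i x => x ^+ a i * gauss_fun x) (fun i => integrable_exprn_gauss (a i)).
have gE (x : euclidean R d) : monomial a x * gauss_fun (norm x) =
    \prod_(i < d) (tnth x i ^+ a i * gauss_fun (tnth x i : R)).
  rewrite big_split; congr (_ * _); rewrite /gauss_fun /= -expR_sum.
  by rewrite sumrN sqr_sqrtr// sumr_ge0// => i _; exact: sqr_ge0.
rewrite /Rintegral cE//.
- by under eq_integral do rewrite gE; rewrite Ea -EFinM.
- exact: measurable_monomial.
- by move=> x; rewrite -am monomial_le.
- move=> t x t0; rewrite /monomial -am -prodrXr -big_split/=; apply: eq_bigr => i _.
  by rewrite tnth_mktuple exprMn.
- by under eq_fun do rewrite gE.
Qed.

End sphere_monomial.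
(** * Complex-valued integrals and kernel operators *)

Section complex_integral.
Context dT (T : measurableType dT) (R : realType).
Variables (mu : {measure set T -> \bar R}) (D : set T).
Hypothesis mD : measurable D.
Implicit Types (f g : T -> R[i]) (c : R[i]).
Local Notation Re := (@complex.Re R).
Local Notation Im := (@complex.Im R).
Local Notation int := (complex_integral mu D).

Lemma ReD (u v : R[i]) : Re (u + v) = Re u + Re v. Proof. by case: u; case: v. Qed.
Lemma ImD (u v : R[i]) : Im (u + v) = Im u + Im v. Proof. by case: u; case: v. Qed.
Lemma ReM (u v : R[i]) : Re (u * v) = Re u * Re v - Im u * Im v.
Proof. by case: u; case: v. Qed.
Lemma ImM (u v : R[i]) : Im (u * v) = Re u * Im v + Im u * Re v.
Proof. by case: u; case: v. Qed.
Lemma complex_eqP (u v : R[i]) : Re u = Re v -> Im u = Im v -> u = v.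
Proof. by case: u => a b; case: v => a' b' /= -> ->. Qed.
Lemma sqr_normc (u : R[i]) : Normc.normc u ^+ 2 = Re u ^+ 2 + Im u ^+ 2.
Proof. by case: u => a b /=; rewrite sqr_sqrtr// addr_ge0// sqr_ge0. Qed.

Definition complex_integrable f :=
  mu.-integrable D (EFin \o (Re \o f)) /\ mu.-integrable D (EFin \o (Im \o f)).

Lemma complex_integrable_measurable f : complex_integrable f -> complex_measurable D f.
Proof.
by move=> [/measurable_int/measurable_EFinP rf /measurable_int/measurable_EFinP mf].
Qed.

(** The real and the imaginary part of [c * f + g] both have this shape. *)
Let integrable_comb (a b : R) (h k l : T -> R) :
  mu.-integrable D (EFin \o h) -> mu.-integrable D (EFin \o k) ->
  mu.-integrable D (EFin \o l) ->
  mu.-integrable D (EFin \o (fun x => a * h x + b * k x + l x)) /\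
  \int[mu]_(x in D) (a * h x + b * k x + l x) =
  a * \int[mu]_(x in D) h x + b * \int[mu]_(x in D) k x + \int[mu]_(x in D) l x.
Proof.
move=> ih ik il.
have iah : mu.-integrable D (EFin \o (fun x => a * h x)).
  by apply: eq_integrable (integrableZl mD a ih).
have ibk : mu.-integrable D (EFin \o (fun x => b * k x)).
  by apply: eq_integrable (integrableZl mD b ik).
have iab : mu.-integrable D (EFin \o (fun x => a * h x + b * k x)).
  by apply: eq_integrable (integrableD mD iah ibk).
split; first by apply: eq_integrable (integrableD mD iab il).
by rewrite RintegralD// RintegralD// !RintegralZl.
Qed.

Lemma complex_integrable_scalar c f g : complex_integrable f -> complex_integrable g ->
  complex_integrable (fun x => c * f x + g x).
Proof.
move=> [rf mf] [rg mg]; split.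
- rewrite (_ : _ \o _ = fun x => Re c * Re (f x) + - Im c * Im (f x) + Re (g x)).
    by have [] := integrable_comb (Re c) (- Im c) rf mf rg.
  by apply/funext => x /=; rewrite ReD ReM mulNr.
- rewrite (_ : _ \o _ = fun x => Re c * Im (f x) + Im c * Re (f x) + Im (g x)).
    by have [] := integrable_comb (Re c) (Im c) mf rf mg.
  by apply/funext => x /=; rewrite ImD ImM.
Qed.

Lemma complex_integral_scalar c f g : complex_integrable f -> complex_integrable g ->
  int (fun x => c * f x + g x) = c * int f + int g.
Proof.
move=> [rf mf] [rg mg]; apply: complex_eqP; rewrite /complex_integral /=.
- rewrite ReD ReM /= -mulNr.
  have [_ <-] := integrable_comb (Re c) (- Im c) rf mf rg.
  by apply: eq_Rintegral => x _; rewrite ReD ReM mulNr.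
- rewrite ImD ImM /=.
  have [_ <-] := integrable_comb (Re c) (Im c) mf rf mg.
  by apply: eq_Rintegral => x _; rewrite ImD ImM.
Qed.

Lemma complex_integrable0 : complex_integrable (fun=> 0).
Proof. by split; apply: integrable0. Qed.

Lemma complex_integral0 : int (fun=> 0) = 0.
Proof. by apply: complex_eqP; rewrite /= /Rintegral integral0_eq. Qed.

Lemma complex_integrableZ c f : complex_integrable f -> complex_integrable (fun x => c * f x).
Proof.
move=> cf; have := complex_integrable_scalar c cf complex_integrable0.
by under eq_fun do rewrite addr0.
Qed.

Lemma complex_integralZ c f : complex_integrable f -> int (fun x => c * f x) = c * int f.
Proof.
move=> cf; have := complex_integral_scalar c cf complex_integrable0.
by under eq_fun do rewrite addr0; rewrite complex_integral0 addr0.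
Qed.

Lemma complex_integrableD f g : complex_integrable f -> complex_integrable g ->
  complex_integrable (fun x => f x + g x).
Proof.
move=> cf cg; have := complex_integrable_scalar 1 cf cg.
by under eq_fun do rewrite mul1r.
Qed.

Lemma complex_integralD f g : complex_integrable f -> complex_integrable g ->
  int (fun x => f x + g x) = int f + int g.
Proof.
move=> cf cg; have := complex_integral_scalar 1 cf cg.
by under eq_fun do rewrite mul1r; rewrite mul1r.
Qed.

Lemma complex_integral_sum (I : Type) (r : seq I) (F : I -> T -> R[i]) :
  (forall i, complex_integrable (F i)) ->
  complex_integrable (fun x => \sum_(i <- r) F i x) /\
  int (fun x => \sum_(i <- r) F i x) = \sum_(i <- r) int (F i).
Proof.
move=> cF; have fE : (fun x => \sum_(i <- r) F i x) = \sum_(i <- r) F i.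
  by apply/funext => x; rewrite fct_sumE.
rewrite fE; elim/big_rec2: _ => [|i b s _ [cs sE]].
  by split; [exact: complex_integrable0|exact: complex_integral0].
by split; [exact: complex_integrableD|rewrite -sE -complex_integralD].
Qed.

Lemma ae_eq_complex_integral f g : complex_measurable D f -> complex_measurable D g ->
  f = g %[ae mu in D] -> int f = int g.
Proof.
move=> [rf mf] [rg mg] fg; rewrite /complex_integral /Rintegral.
congr Complex; congr fine; apply: ae_eq_integral => //; try exact/measurable_EFinP.
- by apply: filterS fg => x + Dx => /(_ Dx) ->.
- by apply: filterS fg => x + Dx => /(_ Dx) ->.
Qed.

End complex_integral.

(** * Measurability of complex-valued functions *)

Section complex_measurable.
Context dT (T : measurableType dT) (R : realType).
Variable D : set T.
Implicit Types (f g : T -> R[i]) (c : R[i]).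

Lemma Re_conjc (u : R[i]) : complex.Re (conjc u) = complex.Re u.
Proof. by case: u. Qed.
Lemma Im_conjc (u : R[i]) : complex.Im (conjc u) = - complex.Im u.
Proof. by case: u. Qed.

Lemma complex_measurable_scalar c f g :
  complex_measurable D f -> complex_measurable D g ->
  complex_measurable D (fun x => c * f x + g x).
Proof.
move=> [rf mf] [rg mg]; split.
- under eq_fun do rewrite ReD ReM.
  by apply: measurable_funD => //; apply: measurable_funB; apply: measurable_funM.
- under eq_fun do rewrite ImD ImM.
  by apply: measurable_funD => //; apply: measurable_funD; apply: measurable_funM.
Qed.

Lemma complex_measurable_cst c : complex_measurable D (fun=> c).
Proof. by split; exact: measurable_cst. Qed.

Lemma complex_measurableM f g :
  complex_measurable D f -> complex_measurable D g ->
  complex_measurable D (fun x => f x * g x).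
Proof.
move=> [rf mf] [rg mg]; split.
- under eq_fun do rewrite ReM.
  by apply: measurable_funB; apply: measurable_funM.
- under eq_fun do rewrite ImM.
  by apply: measurable_funD; apply: measurable_funM.
Qed.

Lemma complex_measurable_conj f :
  complex_measurable D f -> complex_measurable D (fun x => conjc (f x)).
Proof.
move=> [rf mf]; split; first by under eq_fun do rewrite Re_conjc.
by under eq_fun do rewrite Im_conjc; exact: measurable_funN.
Qed.

Lemma complex_measurableD f g :
  complex_measurable D f -> complex_measurable D g ->
  complex_measurable D (fun x => f x + g x).
Proof.
move=> mf mg; have := complex_measurable_scalar 1 mf mg.
by under eq_fun do rewrite mul1r.
Qed.

Lemma complex_measurable_sum (I : Type) (r : seq I) (F : I -> T -> R[i]) :
  (forall i, complex_measurable D (F i)) ->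
  complex_measurable D (fun x => \sum_(i <- r) F i x).
Proof.
move=> mF; rewrite (_ : (fun x => _) = \sum_(i <- r) F i); last first.
  by apply/funext => x; rewrite fct_sumE.
elim/big_rec: _ => [|i b _ mb]; first exact: complex_measurable_cst.
exact: complex_measurableD.
Qed.

Lemma measurable_sqr_normc f : complex_measurable D f ->
  measurable_fun D (fun x => Normc.normc (f x) ^+ 2).
Proof.
move=> [rf mf]; under eq_fun do rewrite sqr_normc.
by apply: measurable_funD; exact: measurable_funX.
Qed.

End complex_measurable.

(** * Square-integrable complex-valued functions *)

Section L2.
Context dT (T : measurableType dT) (R : realType).
Variables (mu : {measure set T -> \bar R}) (D : set T).
Hypothesis mD : measurable D.
Implicit Types (f g : T -> R[i]) (c : R[i]).

Lemma in_L2_integrable f : in_L2 mu D f ->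
  mu.-integrable D (fun x => (Normc.normc (f x) ^+ 2)%:E).
Proof.
move=> [mf foo]; apply/integrableP; split.
  exact/measurable_EFinP/measurable_sqr_normc.
rewrite (le_lt_trans _ foo)// /sqr_L2norm le_eqVlt; apply/orP; left; apply/eqP.
by apply: eq_integral => x _; rewrite /= ger0_norm// sqr_ge0.
Qed.

Lemma in_L2_le f (k : T -> R) : complex_measurable D f ->
  mu.-integrable D (EFin \o k) ->
  (forall x, D x -> Normc.normc (f x) ^+ 2 <= k x) -> in_L2 mu D f.
Proof.
move=> mf /integrableP[/measurable_EFinP mk koo] fk; split=> //.
apply: le_lt_trans koo; apply: ge0_le_integral => //.
- by move=> x _; rewrite lee_fin sqr_ge0.
- exact/measurable_EFinP/measurable_sqr_normc.
- exact/measurable_EFinP/measurableT_comp.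
- by move=> x Dx; rewrite lee_fin (le_trans (fk x Dx))// ler_norm.
Qed.

(* AM-GM, with a weight t that is sent to infinity. *)
Lemma ler_norm_ReM (t : R) (u v : R[i]) : 0 < t ->
  `|complex.Re (u * v)| <= t * Normc.normc u ^+ 2 + t^-1 * Normc.normc v ^+ 2.
Proof.
move=> t0; rewrite !sqr_normc; case: u v => [a b] [a' b'] /=.
have E (x y : R) : `|x * y| <= t * x ^+ 2 + t^-1 * y ^+ 2.
  have s0 : 0 <= (t * `|x| - `|y|) ^+ 2 / t by rewrite divr_ge0 ?sqr_ge0// ltW.
  rewrite -subr_ge0 normrM.
  have -> : t * x ^+ 2 + t^-1 * y ^+ 2 - `|x| * `|y| =
      (t * `|x| - `|y|) ^+ 2 / t + `|x| * `|y|.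
    by rewrite -(real_normK (num_real x)) -(real_normK (num_real y)); field; rewrite gt_eqF.
  by rewrite addr_ge0// mulr_ge0.
rewrite !mulrDr addrACA (le_trans (ler_normB _ _))//; exact: lerD.
Qed.

(** Im(uv) is the real part of (-iu)v, and multiplication by -i preserves the modulus. *)
Lemma ler_norm_ImM (t : R) (u v : R[i]) : 0 < t ->
  `|complex.Im (u * v)| <= t * Normc.normc u ^+ 2 + t^-1 * Normc.normc v ^+ 2.
Proof.
move=> t0; have := ler_norm_ReM (u * Complex 0 (-1)) v t0.
rewrite !sqr_normc; case: u v => [a b] [a' b'] /=.
set l := `|_|; set l' := `|_|; have -> : l = l' by congr `|_|; ring.
by move=> /le_trans; apply; rewrite le_eqVlt; apply/orP; left; apply/eqP; ring.
Qed.

Lemma in_L2_mul f g : in_L2 mu D f -> in_L2 mu D g ->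
  complex_integrable mu D (fun x => f x * g x).
Proof.
move=> Lf Lg; have [[mf _] [mg _]] := (Lf, Lg).
have [rm im] := complex_measurableM mf mg.
have := integrableD mD (in_L2_integrable Lf) (in_L2_integrable Lg).
move=> ifg; split; apply: le_integrable ifg => //; try exact/measurable_EFinP.
- move=> x _ /=; rewrite lee_fin (le_trans (ler_norm_ReM _ _ ltr01))//.
  by rewrite invr1 !mul1r ler_norm.
- move=> x _ /=; rewrite lee_fin (le_trans (ler_norm_ImM _ _ ltr01))//.
  by rewrite invr1 !mul1r ler_norm.
Qed.

Lemma sqr_normc_conjc (u : R[i]) : Normc.normc (conjc u) ^+ 2 = Normc.normc u ^+ 2.
Proof. by rewrite !sqr_normc Re_conjc Im_conjc sqrrN. Qed.

Lemma in_L2_conj f : in_L2 mu D f -> in_L2 mu D (fun x => conjc (f x)).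
Proof.
move=> [mf foo]; split; first exact: complex_measurable_conj.
rewrite /sqr_L2norm; under eq_integral do rewrite sqr_normc_conjc.
exact: foo.
Qed.

Lemma in_L2_scalar c f g : in_L2 mu D f -> in_L2 mu D g ->
  in_L2 mu D (fun x => c * f x + g x).
Proof.
move=> Lf Lg; have [[mf _] [mg _]] := (Lf, Lg).
pose C := 2 * Normc.normc c ^+ 2.
have iC := integrableZl mD C (in_L2_integrable Lf).
have i2 := integrableZl mD 2 (in_L2_integrable Lg).
pose k x := C * Normc.normc (f x) ^+ 2 + 2 * Normc.normc (g x) ^+ 2.
apply: (@in_L2_le _ k).
- exact: complex_measurable_scalar.
- by apply: eq_integrable (integrableD mD iC i2).
- move=> x _; rewrite /k /C !sqr_normc.
  case: (c) (f x) (g x) => [c1 c2] [a b] [a' b'] /=; rewrite -subr_ge0.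
  set z := (X in 0 <= X).
  (* Parallelogram identity: 2|cf|^2 + 2|g|^2 - |cf + g|^2 = |cf - g|^2. *)
  have -> : z = ((c1 * a - c2 * b) - a') ^+ 2 + ((c1 * b + c2 * a) - b') ^+ 2.
    by rewrite /z; ring.
  by rewrite addr_ge0// sqr_ge0.
Qed.

Lemma in_L2_0 : in_L2 mu D (fun=> 0).
Proof.
split; first exact: complex_measurable_cst.
by rewrite /sqr_L2norm integral0_eq// => x _; rewrite sqr_normc/= expr0n addr0.
Qed.

Lemma in_L2_sum (I : Type) (r : seq I) (F : I -> T -> R[i]) :
  (forall i, in_L2 mu D (F i)) -> in_L2 mu D (fun x => \sum_(i <- r) F i x).
Proof.
move=> LF; rewrite (_ : (fun x => _) = \sum_(i <- r) F i); last first.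
  by apply/funext => x; rewrite fct_sumE.
elim/big_rec: _ => [|i b _ Lb]; first exact: in_L2_0.
by have := in_L2_scalar 1 (LF i) Lb; under eq_fun do rewrite mul1r.
Qed.

Lemma in_L2_scale c f : in_L2 mu D f -> in_L2 mu D (fun x => c * f x).
Proof.
by move=> Lf; have := in_L2_scalar c Lf in_L2_0; under eq_fun do rewrite addr0.
Qed.

End L2.

(** * Sections of an integrable kernel *)

Section kernel_sections.
Context dT (T : measurableType dT) (R : realType).
Variables (mu : {sigma_finite_measure set T -> \bar R}) (D : set T).
Hypothesis mD : measurable D.
Local Notation mu2 := (mu \x mu)%E.
Variable H : T * T -> R.
Hypothesis iH : mu2.-integrable (D `*` D) (EFin \o H).

Let mDD : measurable (D `*` D). Proof. exact: measurableX. Qed.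
(** Extension by zero, so that Fubini's theorem can be used on the whole product. *)
Let H0 : T * T -> \bar R := (EFin \o H) \_ (D `*` D).
Let iH0 : mu2.-integrable setT H0.
Proof. by apply/(integrable_mkcond _ mDD). Qed.

Let H0_section z : D z -> (fun x => H0 (x, z)) = (fun x => (H (x, z))%:E) \_ D.
Proof.
move=> Dz; apply/funext => x; rewrite /H0 /= !patchE in_setX /=.
by rewrite (mem_set Dz) andbT.
Qed.

Let fubini_G_section z : D z -> fubini_G mu H0 z = (\int[mu]_(x in D) (H (x, z))%:E)%E.
Proof. by move=> Dz; rewrite /fubini_G [RHS]integral_mkcond -(H0_section Dz). Qed.

Lemma ae_integrable_section :
  {ae mu, forall z, D z -> mu.-integrable D (fun x => (H (x, z))%:E)}.
Proof.
apply: filterS (ae_integrable2 iH0) => z + Dz.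
by rewrite (H0_section Dz) -integrable_mkcond.
Qed.

Lemma measurable_section_integral :
  measurable_fun D (fun z => \int[mu]_(x in D) H (x, z)).
Proof.
apply: (eq_measurable_fun (fine \o fubini_G mu H0)).
  by move=> z /set_mem Dz; rewrite /= fubini_G_section.
apply/measurable_funTS/measurableT_comp; first exact: fine_measurable.
exact: (measurable_fubini_G iH0).
Qed.

(** Triangle inequality for the inner integral, then Tonelli's theorem. *)
Lemma le_section_integral :
  (\int[mu]_(z in D) `|\int[mu]_(x in D) H (x, z)|%:E <=
   \int[mu2]_(z in D `*` D) `|H z|%:E)%E.
Proof.
have mH0 := measurable_int _ iH0.
have mG : measurable_fun setT (fubini_G mu H0) by exact: (measurable_fubini_G iH0).
apply: (@le_trans _ _ (\int[mu]_(z in D) `|fubini_G mu H0 z|)%E).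
  apply: ge0_le_integral => //.
  - apply/measurable_EFinP/measurableT_comp => //.
    exact: measurable_section_integral.
  - by apply/measurable_funTS/measurableT_comp.
  (* The real-valued integral replaces infinite values by 0, which can only decrease the absolute
     value. *)
  - move=> z Dz; rewrite fubini_G_section// /Rintegral.
    by case: (integral _ _ _) => [r| |] //=; rewrite leey.
apply: (@le_trans _ _ (\int[mu]_z `|fubini_G mu H0 z|)%E).
  by apply: ge0_subset_integral => //; apply: measurableT_comp.
have maH0 : measurable_fun setT (abse \o H0) by apply: measurableT_comp.
apply: (@le_trans _ _ (\int[mu]_z \int[mu]_x `|H0 (x, z)|)%E).
  apply: ge0_le_integral => //.
  - exact: (measurableT_comp (@abse_measurable R setT) mG).
  - by apply: (measurable_fun_fubini_tonelli_G (m1 := mu) (abse \o H0) maH0) => z; exact: abse_ge0.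
  - move=> z _; rewrite /fubini_G; apply: le_abse_integral => //.
    by apply: measurableT_comp => //; exact: pair2_measurable.
rewrite -[X in (X <= _)%E](fubini_tonelli2 (abse \o H0) maH0 (fun z => abse_ge0 (H0 z))).
rewrite le_eqVlt; apply/orP; left; apply/eqP; rewrite [RHS]integral_mkcond.
apply: eq_integral => z _; rewrite /H0 /= !patchE.
by case: ifP => //= _; rewrite normr0.
Qed.

End kernel_sections.

(** * Operators given by square-integrable kernels *)

Section kernel_operator.
Context dT (T : measurableType dT) (R : realType).
Variables (mu : {finite_measure set T -> \bar R}) (D : set T).
Hypothesis mD : measurable D.
Local Notation mu2 := (mu \x mu)%E.
Local Notation DD := (D `*` D).
Implicit Types (G : T * T -> R[i]) (f g : T -> R[i]).

Definition kernel_operator G f (z : T) : R[i] :=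
  complex_integral mu D (fun x => G (x, z) * conjc (f x)).

Let mDD : measurable DD. Proof. exact: measurableX. Qed.

Lemma complex_measurable_fst f : complex_measurable D f ->
  complex_measurable DD (fun z => f z.1).
Proof.
by move=> [rf mf]; split; [apply: (measurable_comp mD _ rf)|apply: (measurable_comp mD _ mf)];
  try (by move=> _ [z [? _] <-]); exact: measurable_funTS.
Qed.

Lemma complex_measurable_snd f : complex_measurable D f ->
  complex_measurable DD (fun z => f z.2).
Proof.
by move=> [rf mf]; split; [apply: (measurable_comp mD _ rf)|apply: (measurable_comp mD _ mf)];
  try (by move=> _ [z [_ ?] <-]); exact: measurable_funTS.
Qed.

Lemma in_L2_prod f g : in_L2 mu D f -> in_L2 mu D g ->
  in_L2 mu2 DD (fun z => f z.1 * g z.2).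
Proof.
move=> Lf Lg; have [[mf _] [mg _]] := (Lf, Lg).
pose k f x := ((fun x => Normc.normc (f x : R[i]) ^+ 2) \_ D) x.
have ik h : in_L2 mu D h -> mu.-integrable setT (EFin \o k h).
  move=> /in_L2_integrable/(integrable_mkcond _ mD).
  apply: eq_integrable => // x _; rewrite /k /= !patchE.
  by case: ifP.
have ifg := integrable_prod_meas (ik f Lf) (ik g Lg).
apply: (@in_L2_le _ _ _ _ _ _ _ (fun z => k f z.1 * k g z.2)) => //.
- by apply: complex_measurableM; [exact: complex_measurable_fst|exact: complex_measurable_snd].
- exact: integrableS ifg.
- move=> z [/= z1 z2]; rewrite /k !patchE !mem_set// !sqr_normc.
  case: (f z.1) (g z.2) => [a b] [a' b'] /=.
  by rewrite le_eqVlt; apply/orP; left; apply/eqP; ring.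
Qed.

Lemma in_L2_cst (c : R[i]) : in_L2 mu D (fun=> c).
Proof.
apply: (@in_L2_le _ _ _ _ _ _ _ (cst (Normc.normc c ^+ 2))) => //.
exact: finite_measure_integrable_cst.
Qed.

(** The measure is finite, so the constant 1 is square integrable and can serve as the second
    factor. *)
Lemma in_L2_fst f : in_L2 mu D f -> in_L2 mu2 DD (fun z => f z.1).
Proof.
move=> Lf; have := in_L2_prod Lf (in_L2_cst 1).
by under eq_fun do rewrite mulr1.
Qed.

Section fixed_kernel.
Variables (G : T * T -> R[i]) (f : T -> R[i]).
Hypotheses (LG : in_L2 mu2 DD G) (Lf : in_L2 mu D f).

Let cG : complex_integrable mu2 DD (fun z => G z * conjc (f z.1)).
Proof.
by apply: in_L2_mul => //; apply: in_L2_conj; exact: in_L2_fst.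
Qed.

Lemma ae_complex_integrable_section :
  {ae mu, forall z, D z -> complex_integrable mu D (fun x => G (x, z) * conjc (f x))}.
Proof.
have [rG iG] := cG.
have := ae_integrable_section mD iG; apply: filterS2 (ae_integrable_section mD rG).
by move=> z zr zi Dz; split; [exact: zr|exact: zi].
Qed.

Lemma measurable_kernel_operator : complex_measurable D (kernel_operator G f).
Proof.
have [rG iG] := cG.
by split; [have := measurable_section_integral mD rG|have := measurable_section_integral mD iG].
Qed.

(** A norm equivalent to the modulus that splits into real and imaginary parts. *)
Definition abs1 (u : R[i]) := `|complex.Re u| + `|complex.Im u|.

Lemma measurable_abs1 g : complex_measurable D g -> measurable_fun D (abs1 \o g).
Proof. by move=> [rg mg]; apply: measurable_funD; exact: measurableT_comp. Qed.

Lemma abs1_ge0 u : 0 <= abs1 u. Proof. by rewrite addr_ge0. Qed.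

(** The weighted AM-GM inequality under the double integral of [le_section_integral]. The factor 2
    counts the real and the imaginary part. *)
Lemma kernel_operator_le (t : R) : 0 < t ->
  (\int[mu]_(z in D) (abs1 (kernel_operator G f z))%:E <=
   2%:E * (t%:E * sqr_L2norm mu2 DD G +
           t^-1%:E * sqr_L2norm mu2 DD (fun z => f z.1)))%E.
Proof.
move=> t0; have [rG iG] := cG.
have [rm im] := measurable_kernel_operator.
rewrite -/(abs1 _) /abs1; under eq_integral do rewrite EFinD.
rewrite ge0_integralD//; [|exact/measurable_EFinP/measurableT_comp..].
rewrite (_ : 2%:E = 1 + 1)%E; last by rewrite -EFinD.
set B := (X in (_ <= _ * X)%E).
have B0 : (0 <= B)%E.
  by rewrite adde_ge0// mule_ge0 ?lee_fin ?invr_ge0 ?(ltW t0)// integral_ge0// => x _;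
    rewrite lee_fin sqr_ge0.
rewrite ge0_muleDl// mul1e.
have [mG _] := LG; have [mf _] := in_L2_fst Lf.
have mNG : measurable_fun DD (fun z => (Normc.normc (G z) ^+ 2)%:E).
  exact/measurable_EFinP/measurable_sqr_normc.
have mNf : measurable_fun DD (fun z => (Normc.normc (f z.1) ^+ 2)%:E).
  exact/measurable_EFinP/measurable_sqr_normc.
have N0 (u : R[i]) : (0 <= (Normc.normc u ^+ 2)%:E)%E by rewrite lee_fin sqr_ge0.
have t0e : (0 <= t%:E)%E by rewrite lee_fin ltW.
have tV0e : (0 <= (t^-1)%:E)%E by rewrite lee_fin invr_ge0 ltW.
have BE : B = (\int[mu2]_(z in DD) (t * Normc.normc (G z) ^+ 2 +
                 t^-1 * Normc.normc (conjc (f z.1)) ^+ 2)%:E)%E.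
  under [RHS]eq_integral do rewrite EFinD sqr_normc_conjc (EFinM t) (EFinM t^-1).
  rewrite ge0_integralD//.
  - by rewrite !ge0_integralZl.
  - by move=> z _; rewrite mule_ge0.
  - exact: measurable_funeM.
  - by move=> z _; rewrite mule_ge0.
  - exact: measurable_funeM.
have mBB : measurable_fun DD (fun z => (t * Normc.normc (G z) ^+ 2 +
                 t^-1 * Normc.normc (conjc (f z.1)) ^+ 2)%:E).
  apply/measurable_EFinP/measurable_funD; apply: measurable_funM => //.
    exact: measurable_sqr_normc.
  by apply: measurable_sqr_normc; exact: complex_measurable_conj.
apply: leeD; [apply: le_trans (le_section_integral mD rG) _|
  apply: le_trans (le_section_integral mD iG) _]; rewrite BE; apply: ge0_le_integral => //.
- by have /measurable_int/measurable_EFinP mr := rG; exact/measurable_EFinP/measurableT_comp.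
- by move=> z _; rewrite lee_fin ler_norm_ReM.
- by have /measurable_int/measurable_EFinP mr := iG; exact/measurable_EFinP/measurableT_comp.
- by move=> z _; rewrite lee_fin ler_norm_ImM.
Qed.

End fixed_kernel.

(** [kernel_operator_le] is applied to the kernel [K - Kn n]: first [t] is taken large to control
    the term of [f], then [n] large to control the term of the kernel. *)
Lemma kernel_operator_cvg (K : T * T -> R[i]) (Kn : nat -> T * T -> R[i]) f :
  in_L2 mu2 DD K -> in_L2 mu D f ->
  (forall n, complex_measurable DD (Kn n)) ->
  (forall n z, complex_integrable mu D (fun x => Kn n (x, z) * conjc (f x))) ->
  sqr_L2norm mu2 DD (fun z => K z - Kn n z) @[n --> \oo] --> 0%E ->
  forall e : R, 0 < e -> \forall n \near \oo,
  (\int[mu]_(z in D) (abs1 (kernel_operator K f z - kernel_operator (Kn n) f z))%:E <= e%:E)%E.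
Proof.
move=> LK Lf mKn iKn Kcvg e e0.
have [_ foo] := in_L2_fst Lf.
pose c := fine (sqr_L2norm mu2 DD (fun z => f z.1)).
have normE0 (h : T * T -> R[i]) : (0 <= sqr_L2norm mu2 DD h)%E.
  by apply: integral_ge0 => z _; rewrite lee_fin sqr_ge0.
have cE : sqr_L2norm mu2 DD (fun z => f z.1) = c%:E.
  by rewrite fineK// ge0_fin_numE.
have c0 : 0 <= c by rewrite -lee_fin -cE.
(* This gives 2c/t <= e/2, while the threshold e/(4t) for the squared kernel norm contributes the
   other e/2. The summand 1 keeps [t] positive when c = 0. *)
pose t := 4 * c / e + 1.
have t0 : 0 < t by rewrite ltr_wpDl// divr_ge0 ?mulr_ge0// ltW.
have := Kcvg; move=> /fine_cvgP[finK /cvgr0Pnorm_le/(_ (e / (4 * t)))].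
rewrite divr_gt0 ?mulr_gt0// => /(_ isT) leK.
near=> n.
pose G z := K z - Kn n z.
have finn : sqr_L2norm mu2 DD G \is a fin_num by rewrite /G; near: n.
have len : (sqr_L2norm mu2 DD G <= (e / (4 * t))%:E)%E.
  rewrite -(fineK finn) lee_fin (le_trans (ler_norm _))//.
  by rewrite /G; near: n.
have LG : in_L2 mu2 DD G.
  split; last by rewrite (le_lt_trans len)// ltry.
  have := complex_measurable_scalar (-1) (mKn n) LK.1.
  by under eq_fun do rewrite mulN1r addrC.
(* [Kn n] is assumed measurable; for this [n] it is square integrable as a difference of [K] and
   [G]. *)
have LKn : in_L2 mu2 DD (Kn n).
  have := in_L2_scalar mDD (-1) LG LK.
  by under eq_fun do rewrite /G mulN1r opprB subrK.
have [mK mKo] : complex_measurable D (kernel_operator K f) /\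
    complex_measurable D (kernel_operator (Kn n) f).
  by split; exact: measurable_kernel_operator.
have mG : complex_measurable D (kernel_operator G f) by exact: measurable_kernel_operator.
have mB : complex_measurable D (fun z => kernel_operator K f z - kernel_operator (Kn n) f z).
  have := complex_measurable_scalar (-1) mKo mK.
  by under eq_fun do rewrite mulN1r addrC.
(* Additivity of the operator in the kernel holds at almost every [z], namely where the section of
   [K] is integrable against [f]. *)
rewrite (@ge0_ae_eq_integral _ _ _ mu D _ (fun z => (abs1 (kernel_operator G f z))%:E))//.
- rewrite (le_trans (kernel_operator_le LG Lf t0))// cE.
  rewrite (@le_trans _ _ (2%:E * (t%:E * (e / (4 * t))%:E + t^-1%:E * c%:E))%E)//.
    by rewrite lee_pmul2l// leeD2r// lee_pmul2l// lte_fin.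
  rewrite -!EFinM lee_fin.
  have -> : 2 * (t * (e / (4 * t)) + t^-1 * c) = e / 2 + 2 * c / t.
    by field; rewrite gt_eqF.
  have : 2 * c / t <= e / 2.
    rewrite ler_pdivrMr// /t; have -> : e / 2 * (4 * c / e + 1) = 2 * c + e / 2.
      by field; rewrite gt_eqF.
    by rewrite lerDl divr_ge0// ltW.
  by rewrite {3}(splitr e); lra.
- exact/measurable_EFinP/measurable_abs1.
- exact/measurable_EFinP/measurable_abs1.
- by move=> z _; rewrite lee_fin abs1_ge0.
- by move=> z _; rewrite lee_fin abs1_ge0.
- apply: filterS (ae_complex_integrable_section LK Lf) => z /[apply] iK.
  rewrite /kernel_operator; congr (abs1 _)%:E.
  have := complex_integral_scalar mD (-1) (iKn n z) iK; rewrite mulN1r => H.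
  rewrite addrC -H; congr complex_integral; apply/funext => x.
  by rewrite /G; ring.
Unshelve. all: by end_near. Qed.

End kernel_operator.
(** * Spherical harmonics *)

Section spherical_harmonics.
Context {R : realType} (d : nat).
Hypothesis d_gt0 : (0 < d)%N.
Local Notation E := (euclidean R d).
Local Notation sigma := (@surface_measure R d).
Local Notation S := (@sphere R d).
Local Notation H := (@spherical_harmonics R d).
Local Notation Re := (@complex.Re R).
Local Notation Im := (@complex.Im R).
Local Notation toC x := [tuple (tnth (x : E) i : R)%:C%C | i < d].
Local Notation eval := Defs.SolidHarmonic.eval.
Local Notation solid_harmonic := Defs.SolidHarmonic.solid_harmonic.

Let mS : measurable S. Proof. exact: measurable_sphere. Qed.

Lemma complex_integrable_monomial (c : R[i]) (a : 'I_d -> nat) :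
  complex_integrable sigma S (fun x => c * (monomial a x)%:C%C) /\
  complex_integral sigma S (fun x => c * (monomial a x)%:C%C) =
  c * (\int[sigma]_(x in S) monomial a x)%:C%C.
Proof.
have im : complex_integrable sigma S (fun x => (monomial a x)%:C%C).
  by split; [exact: integrable_monomial|exact: integrable0].
split; first exact: complex_integrableZ.
rewrite complex_integralZ//; congr (_ * _); apply: complex_eqP => //=.
by rewrite /Rintegral integral0.
Qed.

Lemma eval_toC_monomials p : exists s : seq (R[i] * {ffun 'I_d -> nat}),
  forall x, eval p (toC x) = \sum_(t <- s) t.1 * (monomial t.2 x)%:C%C.
Proof.
have [s sE] := HarmonicMoments.eval_monomials p; exists s => x.
rewrite sE; apply: eq_bigr => t _; congr (_ * _); rewrite /monomial rmorph_prod.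
by apply: eq_bigr => i _; rewrite tnth_mktuple rmorphXn.
Qed.

Lemma complex_measurable_eval p : complex_measurable S (fun x => eval p (toC x)).
Proof.
have [s sE] := eval_toC_monomials p; under eq_fun do rewrite sE.
apply: complex_measurable_sum => t.
by have [/complex_integrable_measurable] := complex_integrable_monomial t.1 t.2.
Qed.

(** Monomials are bounded by 1 on the sphere, so the sum of the sizes of the coefficients is a
    bound. *)
Lemma eval_bounded p : exists2 C : R, 0 <= C &
  forall x, S x -> `|Re (eval p (toC x))| <= C /\ `|Im (eval p (toC x))| <= C.
Proof.
have [s sE] := eval_toC_monomials p.
exists (\sum_(t <- s) abs1 t.1); first by apply: sumr_ge0 => t _; exact: abs1_ge0.
move=> x Sx; rewrite sE.
have m1 (a : 'I_d -> nat) : `|monomial a x| <= 1.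
  by rewrite (le_trans (monomial_le _ _))// Sx expr1n.
elim: s {sE} => [|t s [IHr IHi]]; first by rewrite !big_nil normr0.
have tle (u : R) : `|u * monomial t.2 x| <= `|u|.
  by rewrite normrM ler_piMr.
rewrite !big_cons ReD ImD ReM ImM /= !mulr0 subr0 add0r; split.
- rewrite (le_trans (ler_normD _ _))// lerD// (le_trans (tle _))//.
  by rewrite /abs1 lerDl.
- rewrite (le_trans (ler_normD _ _))// lerD// (le_trans (tle _))//.
  by rewrite /abs1 lerDr.
Qed.

Lemma spherical_harmonics_scalar j c f g :
  H j f -> H j g -> H j (fun x => c * f x + g x).
Proof.
move=> [Lf [p hp fp]] [Lg [q hq gq]]; split; first exact: in_L2_scalar.
apply: (ex_intro2 _ _ _ (HarmonicMoments.solid_harmonic_scalar c hp hq)).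
apply: filterS2 fp gq => x fx gx Sx.
by rewrite HarmonicMoments.eval_scalar fx// gx.
Qed.

Lemma spherical_harmonics0 j : H j (fun=> 0).
Proof.
split; first exact: in_L2_0.
apply: (ex_intro2 _ _ _ (HarmonicMoments.solid_harmonic0 _ _ j)).
by apply/aeW => x _; rewrite HarmonicMoments.eval0.
Qed.

Lemma spherical_harmonics_sum j (I : finType) (F : I -> E -> R[i]) (c : I -> R[i]) :
  (forall i, H j (F i)) -> H j (fun x => \sum_i c i * F i x).
Proof.
move=> HF; rewrite (_ : (fun x => _) = \sum_i (fun x => c i * F i x)); last first.
  by apply/funext => x; rewrite fct_sumE.
elim/big_rec: _ => [|i b _ Hb]; first exact: spherical_harmonics0.
exact: spherical_harmonics_scalar.
Qed.

(** The points of the sphere are real, so conjugating a value amounts to conjugating the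
    coefficients. *)
Lemma spherical_harmonics_conj j f : H j f -> H j (fun x => conjc (f x)).
Proof.
move=> [Lf [p hp fp]]; split; first exact: in_L2_conj.
have [q hq qE] := HarmonicMoments.solid_harmonic_map (@conjc R) hp; exists q => //.
apply: filterS fp => x fx Sx; rewrite fx// qE; congr (eval q _).
apply: eq_from_tnth => i; rewrite !tnth_mktuple; exact: conjc_real.
Qed.

(** The moment functional vanishes on the product of the two polynomials, and
    [surface_integral_monomial] transfers this to the sphere in degree [j + l], which is positive
    because [j != l]. *)
Lemma integral_spherical_harmonicsM j l f g : j != l -> H j f -> H l g ->
  complex_integral sigma S (fun x => f x * g x) = 0.
Proof.
move=> jl [[mf _] [p hp fp]] [[mg _] [q hq gq]].
pose M n : R[i] := (gauss_moment n)%:C%C.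
have M1 : M 1%N = 0.
  have := @gauss_momentS R 0; rewrite mul0r => /eqP; rewrite mulf_eq0.
  by rewrite pnatr_eq0/= => /eqP; rewrite /M => ->.
have MS n : 2 * M n.+2 = n.+1%:R * M n.
  by rewrite /M -[2]/(2%:R) -!(rmorph_nat (real_complex R)) -!rmorphM gauss_momentS.
have [s [sE sdeg s0]] := HarmonicMoments.solid_harmonic_mul M1 MS jl hp hq.
have m0 : (0 < j + l)%N.
  by case: (j) (l) jl => [|?] [|?].
have [c cE] := @surface_integral_monomial R d _ d_gt0 m0.
have pqE x : eval p (toC x) * eval q (toC x) =
    \sum_(t <- s) t.1 * (monomial t.2 x)%:C%C.
  rewrite sE; apply: eq_bigr => t _; congr (_ * _); rewrite /monomial rmorph_prod.
  by apply: eq_bigr => i _; rewrite tnth_mktuple rmorphXn.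
rewrite (@ae_eq_complex_integral _ _ _ _ _ mS _ (fun x => eval p (toC x) * eval q (toC x))).
- under [X in complex_integral _ _ X]eq_fun do rewrite pqE.
  have [_ ->] := complex_integral_sum mS s
    (fun t => (complex_integrable_monomial t.1 t.2).1).
  transitivity (c%:C%C * \sum_(t <- s) t.1 * \prod_(i < d) M (t.2 i));
    last by rewrite s0 mulr0.
  rewrite mulr_sumr big_seq [RHS]big_seq; apply: eq_bigr => t ts.
  rewrite (complex_integrable_monomial _ _).2 (cE _ (sdeg t ts)).
  by rewrite rmorphM rmorph_prod mulrCA.
- exact: complex_measurableM.
- by apply: complex_measurableM; exact: complex_measurable_eval.
- by apply: filterS2 fp gq => x fx gx Sx; rewrite fx// gx.
Qed.

Lemma L2_inner_spherical_harmonics j l f g : j != l -> H j f -> H l g ->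
  L2_inner sigma S f g = 0.
Proof.
by move=> jl Hf Hg; apply: integral_spherical_harmonicsM jl Hf _; exact: spherical_harmonics_conj.
Qed.

End spherical_harmonics.

(** * Partial sums of the expansion and their operators *)

Section kernel_expansion.
Context {R : realType} (d : nat).
Hypothesis d_gt0 : (0 < d)%N.
Local Notation E := (euclidean R d).
Local Notation sigma := (@surface_measure R d).
Local Notation S := (@sphere R d).
Local Notation H := (@spherical_harmonics R d).
Variables (N : nat -> nat) (Y : forall j, 'I_(N j) -> E -> R[i]).
Hypothesis Y_basis : forall j, orthonormal_basis sigma S (@Y j) (H j).
Variable a : forall j j', 'I_(N j) -> 'I_(N j') -> R[i].
Local Notation partial := (kernel_partial_sum Y a).
Local Notation op := (kernel_operator sigma S).

Let mS : measurable S. Proof. exact: measurable_sphere. Qed.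

Lemma basis_harmonic j k : H j (@Y j k).
Proof. by have [HY _ _] := Y_basis j; exact: HY. Qed.

Lemma basis_L2 j k : in_L2 sigma S (@Y j k).
Proof. by have [] := basis_harmonic k. Qed.

Lemma basis_orthonormal j k l : L2_inner sigma S (@Y j k) (@Y j l) = (k == l)%:R.
Proof. by have [_ oY _] := Y_basis j; exact: oY. Qed.

Lemma measurable_partial_sum n : complex_measurable (S `*` S) (partial n).
Proof.
apply: complex_measurable_sum => j; apply: complex_measurable_sum => j'.
apply: complex_measurable_sum => k; apply: complex_measurable_sum => k'.
apply: complex_measurableM.
  apply: complex_measurableM; first exact: complex_measurable_cst.
  exact: (complex_measurable_fst mS (basis_L2 k).1).
exact: (complex_measurable_snd mS (complex_measurable_conj (basis_L2 k').1)).
Qed.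

(** Integrability and value are kept together so that the statement can be chained through the four
    nested sums. *)
Let sumP (I : finType) (F : I -> E -> R[i]) (G : I -> R[i]) :
  (forall i, complex_integrable sigma S (F i) /\ complex_integral sigma S (F i) = G i) ->
  complex_integrable sigma S (fun x => \sum_i F i x) /\
  complex_integral sigma S (fun x => \sum_i F i x) = \sum_i G i.
Proof.
move=> FG; have [iF ->] := complex_integral_sum mS (index_enum I) (fun i => (FG i).1).
by split=> //; apply: eq_bigr => i _; exact: (FG i).2.
Qed.

(** The sums are finite, so the formula holds at every [z], without an exceptional null set. *)
Lemma partial_sum_operator n f z : in_L2 sigma S f ->
  complex_integrable sigma S (fun x => partial n (x, z) * conjc (f x)) /\
  op (partial n) f z = \sum_(j < n) \sum_(j' < n) \sum_(k < N j) \sum_(k' < N j')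
    (a k k' * conjc (Y k' z)) * L2_inner sigma S (Y k) f.
Proof.
move=> Lf.
rewrite /kernel_operator.
have -> : (fun x => partial n (x, z) * conjc (f x)) =
    (fun x => \sum_(j < n) \sum_(j' < n) \sum_(k < N j) \sum_(k' < N j')
    (a k k' * conjc (Y k' z)) * (Y k x * conjc (f x))).
  apply/funext => x; rewrite /kernel_partial_sum.
  do 4 (rewrite mulr_suml; apply: eq_bigr => ? _).
  by rewrite /=; ring.
apply: (sumP) => j; apply: (sumP) => j'; apply: (sumP) => k; apply: (sumP) => k'.
have iYf := in_L2_mul mS (basis_L2 k) (in_L2_conj Lf).
by split; [exact: complex_integrableZ|rewrite complex_integralZ].
Qed.

Lemma in_L2_partial_sum_operator n f : in_L2 sigma S f -> in_L2 sigma S (op (partial n) f).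
Proof.
move=> Lf; rewrite (funext (fun z => (partial_sum_operator n z Lf).2)).
apply: in_L2_sum => // j; apply: in_L2_sum => // j'.
apply: in_L2_sum => // k; apply: in_L2_sum => // k'.
under eq_fun do rewrite mulrAC; apply: in_L2_scale => //.
by apply: in_L2_conj; exact: basis_L2.
Qed.

(* The kernel acts diagonally on degrees, so on H_j only the degree j part of
   the expansion survives. *)
Lemma diagonal_partial_sum_operator n j f z : (j < n)%N ->
  (forall l l' (k : 'I_(N l)) (k' : 'I_(N l')), l != l' -> a k k' = 0) -> H j f ->
  op (partial n) f z = \sum_(k' < N j)
    (\sum_(k < N j) a k k' * L2_inner sigma S (Y k) f) * conjc (Y k' z).
Proof.
move=> jn a0 Hf; have [_ ->] := partial_sum_operator n z Hf.1.
rewrite (bigD1 (Ordinal jn))//= [X in _ + X]big1 ?addr0; last first.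
  move=> l lj; apply: big1 => l' _; apply: big1 => k _; apply: big1 => k' _.
  rewrite (L2_inner_spherical_harmonics d_gt0 _ (basis_harmonic k) Hf) ?mulr0//.
rewrite (bigD1 (Ordinal jn))//= [X in _ + X]big1 ?addr0; last first.
  move=> l' lj; apply: big1 => k _; apply: big1 => k' _.
  by rewrite a0 ?mul0r// eq_sym.
rewrite exchange_big/=; apply: eq_bigr => k' _; rewrite mulr_suml.
by apply: eq_bigr => k _; ring.
Qed.

(** The operator produces conjugates of basis functions, hence the pairing with [Y k'] is taken
    without conjugation. Orthogonality of degrees isolates [j] and [j'], then orthonormality
    isolates [k] and [k']. *)
Lemma partial_sum_coefficient n j j' (k : 'I_(N j)) (k' : 'I_(N j')) :
  (j < n)%N -> (j' < n)%N ->
  complex_integral sigma S (fun z => op (partial n) (Y k) z * Y k' z) = a k k'.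
Proof.
move=> jn jn'.
have -> : (fun z => op (partial n) (Y k) z * Y k' z) =
    (fun z => \sum_(l < n) \sum_(l' < n) \sum_(m < N l) \sum_(m' < N l')
    (a m m' * L2_inner sigma S (Y m) (Y k)) * (Y k' z * conjc (Y m' z))).
  apply/funext => z; rewrite (partial_sum_operator n z (basis_L2 k)).2.
  do 4 (rewrite mulr_suml; apply: eq_bigr => ? _).
  by ring.
transitivity (\sum_(l < n) \sum_(l' < n) \sum_(m < N l) \sum_(m' < N l')
    (a m m' * L2_inner sigma S (Y m) (Y k)) * L2_inner sigma S (Y k') (Y m')).
  apply: (fun h => (sumP h).2) => l; apply: sumP => l'; apply: sumP => m; apply: sumP => m'.
  have iYY := in_L2_mul mS (basis_L2 k') (in_L2_conj (basis_L2 m')).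
  by split; [exact: complex_integrableZ|rewrite complex_integralZ].
rewrite (bigD1 (Ordinal jn))//= [X in _ + X]big1 ?addr0; last first.
  move=> l lj; apply: big1 => l' _; apply: big1 => m _; apply: big1 => m' _.
  rewrite (L2_inner_spherical_harmonics d_gt0 lj (basis_harmonic m) (basis_harmonic k)).
  by rewrite mulr0 mul0r.
rewrite (bigD1 (Ordinal jn'))//= [X in _ + X]big1 ?addr0; last first.
  move=> l' lj; apply: big1 => m _; apply: big1 => m' _.
  have j'l : j' != l' by rewrite eq_sym.
  rewrite (L2_inner_spherical_harmonics d_gt0 j'l (basis_harmonic k') (basis_harmonic m')).
  exact: mulr0.
rewrite (bigD1 k)//= [X in _ + X]big1 ?addr0; last first.
  move=> m mk; apply: big1 => m' _.
  by rewrite basis_orthonormal (negPf mk) mulr0 mul0r.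
rewrite (bigD1 k')//= [X in _ + X]big1 ?addr0; last first.
  by move=> m mk; rewrite !basis_orthonormal eq_sym (negPf mk) mulr0.
by rewrite !basis_orthonormal !eqxx !mulr1.
Qed.

End kernel_expansion.

(** * Consequences of smallness in L^1 *)

Lemma ae_eq0_abs1 dT (T : measurableType dT) (R : realType)
    (mu : {measure set T -> \bar R}) (D : set T) (g : T -> R[i]) :
  measurable D -> complex_measurable D g ->
  (forall e : R, 0 < e -> (\int[mu]_(x in D) (abs1 (g x))%:E <= e%:E)%E) ->
  g = (fun=> 0) %[ae mu in D].
Proof.
move=> mD mg le_e.
have int0 : (\int[mu]_(x in D) `|(abs1 (g x))%:E| = 0)%E.
  apply/eqP; rewrite eq_le integral_ge0 ?andbT//; apply/lee_addgt0Pr => e e0.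
  rewrite add0e (le_trans _ (le_e e e0))// le_eqVlt; apply/orP; left; apply/eqP.
  by apply: eq_integral => x _; rewrite gee0_abs// lee_fin abs1_ge0.
have := (ae_eq_integral_abs mu mD _).1 int0.
move=> /(_ _)/[!measurable_EFinP]/(_ (measurable_abs1 mg)).
apply: filterS => x gx Dx; have := gx Dx; rewrite /abs1 => -[] /eqP.
rewrite paddr_eq0// !normr_eq0 => /andP[/eqP r0 /eqP i0].
exact: complex_eqP.
Qed.

(* Only the boundedness of the polynomial representing [g] is used, so that
   L^1 control of [u] suffices. *)
Lemma abs1_integral_mul_le (R : realType) d j (g : euclidean R d -> R[i]) :
  @spherical_harmonics R d j g ->
  exists2 C : R, 0 < C & forall u e,
  in_L2 (@surface_measure R d) (@sphere R d) u ->
  (\int[@surface_measure R d]_(x in @sphere R d) (abs1 (u x))%:E <= e%:E)%E ->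
  abs1 (complex_integral (@surface_measure R d) (@sphere R d) (fun x => u x * g x)) <= C * e.
Proof.
move=> [[mg goo] [p hp gp]].
have mS := @measurable_sphere R d.
have [C C0 pC] := eval_bounded p.
(* The real and the imaginary part contribute [C] each; the summand 1 makes the constant
   positive. *)
exists (2 * C + 1); first by rewrite ltr_wpDl// mulr_ge0.
move=> u e [mu _] ue.
pose q x := Defs.SolidHarmonic.eval p [tuple (tnth (x : euclidean R d) i : R)%:C%C | i < d].
have mq : complex_measurable (@sphere R d) q by exact: complex_measurable_eval.
have muq : complex_measurable (@sphere R d) (fun x => u x * q x) by exact: complex_measurableM.
have mau := (measurable_EFinP _ _).2 (measurable_abs1 mu).
rewrite (ae_eq_complex_integral mS (complex_measurableM mu mg) muq); last first.
  by apply: filterS gp => x gx Sx; rewrite gx.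
have bound (h : euclidean R d -> R) : measurable_fun (@sphere R d) h ->
    (forall x, @sphere R d x -> `|h x| <= C * abs1 (u x)) ->
    `|\int[@surface_measure R d]_(x in @sphere R d) h x| <= C * e.
  move=> mh hle.
  have hCe : (\int[@surface_measure R d]_(x in @sphere R d) `|(h x)%:E| <= (C * e)%:E)%E.
    rewrite EFinM (@le_trans _ _ (C%:E *
        \int[@surface_measure R d]_(x in @sphere R d) (abs1 (u x))%:E)%E)//; last first.
      by rewrite lee_wpmul2l.
    rewrite -ge0_integralZl//; last by move=> x _; rewrite lee_fin abs1_ge0.
    apply: ge0_le_integral => //.
    - exact/measurableT_comp/measurable_EFinP.
    - exact: measurable_funeM.
  have ih : (@surface_measure R d).-integrable (@sphere R d) (EFin \o h).
    apply/integrableP; split; first exact/measurable_EFinP.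
    by rewrite (le_lt_trans hCe)// ltry.
  rewrite -lee_fin (le_trans _ hCe)// EFin_normr_Rintegral//.
  by apply: le_abse_integral => //; exact/measurable_EFinP.
have e0 : 0 <= e.
  rewrite -lee_fin (le_trans _ ue)//; apply: integral_ge0 => x _.
  by rewrite lee_fin abs1_ge0.
have uq x : @sphere R d x -> `|complex.Re (u x * q x)| <= C * abs1 (u x) /\
    `|complex.Im (u x * q x)| <= C * abs1 (u x).
  move=> Sx; have [rC iC] := pC x Sx; rewrite /abs1 mulrDr ReM ImM; split.
  - by rewrite (le_trans (ler_normB _ _))// !normrM ![_ * `|_ (q x)|]mulrC lerD// ler_wpM2r.
  - by rewrite (le_trans (ler_normD _ _))// !normrM ![_ * `|_ (q x)|]mulrC lerD// ler_wpM2r.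
have := lerD (bound _ muq.1 (fun x Sx => (uq x Sx).1)) (bound _ muq.2 (fun x Sx => (uq x Sx).2)).
move=> /le_trans; apply; rewrite mulrDl mul1r -mulr2n mulr_natl -mulrnAl.
by rewrite lerDl.
Qed.

(** * Invariance of the spaces of harmonics and coefficients diagonal in the degree *)

Theorem lemma3 (R : realType) (d : nat) (d_ge2 : (2 <= d)%N)
    (N : nat -> nat) (Y : forall j : nat, 'I_(N j) -> euclidean R d -> R[i])
    (Y_basis : forall j : nat,
       orthonormal_basis (@surface_measure R d) (@sphere R d) (Y j)
         (@spherical_harmonics R d j))
    (K : euclidean R d * euclidean R d -> R[i])
    (K_L2 : in_L2_kernel K) (K_herm : hermitian_kernel K)
    (a : forall j j' : nat, 'I_(N j) -> 'I_(N j') -> R[i])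
    (K_expansion : kernel_expansion Y a K) :
  (forall (j : nat) (f : euclidean R d -> R[i]), spherical_harmonics j f ->
     spherical_harmonics j (fun zeta : euclidean R d =>
       complex_integral (@surface_measure R d) (@sphere R d)
         (fun xi : euclidean R d => K (xi, zeta) * conjc (f xi)))) <->
  (exists D : nat -> nat -> nat -> R[i],
     forall (j j' : nat) (k : 'I_(N j)) (k' : 'I_(N j')),
       a j j' k k' = (j == j')%:R * D j k k').
Proof.
have d_gt0 : (0 < d)%N := ltnW d_ge2.
have mS := @measurable_sphere R d.
pose op := kernel_operator (@surface_measure R d) (@sphere R d).
have cvg f (Lf : in_L2 (@surface_measure R d) (@sphere R d) f) :=
  kernel_operator_cvg mS K_L2 Lf (measurable_partial_sum Y_basis a)
    (fun n z => (partial_sum_operator Y_basis a n z Lf).1) K_expansion.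
have mop f : in_L2 (@surface_measure R d) (@sphere R d) f ->
    complex_measurable (@sphere R d) (op K f) by exact: measurable_kernel_operator.
split=> [opH|[D aD] j f Hf].
  have a0 j j' k k' : j != j' -> a j j' k k' = 0.
    move=> jj'; have HY := basis_harmonic Y_basis k; have HY' := basis_harmonic Y_basis k'.
    have opY := opH j _ HY; rewrite -/(op K (Y j k)) in opY.
    have [C C0 leC] := abs1_integral_mul_le HY'.
    (* The coefficient is an integral involving the partial sum operator. It differs from the
       integral for [K], which is 0, by at most [C] times an L^1 distance; hence the tolerance
       [e / C]. *)
    have small e : 0 < e -> abs1 (a j j' k k') <= e.
      move=> e0; have eC0 : 0 < e / C by rewrite divr_gt0.
      (* The index lies beyond the threshold of convergence and above both degrees, so the
         coefficient occurs in the partial sum. *)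
      have [n0 _ /(_ (maxn n0 (maxn j j').+1) (leq_maxl _ _))] := cvg _ HY.1 _ eC0.
      set n := maxn _ _.
      have jn : (j < n)%N by rewrite leq_max ltnS leq_maxl orbT.
      have jn' : (j' < n)%N by rewrite leq_max ltnS leq_maxr orbT.
      have Ln := in_L2_partial_sum_operator Y_basis a n HY.1.
      have Lu := in_L2_scalar mS (-1) Ln opY.1.
      rewrite (_ : (fun z => _) = fun z => (abs1
        (-1 * op (kernel_partial_sum Y a n) (Y j k) z + op K (Y j k) z))%:E); last first.
        by apply/funext => z; rewrite mulN1r addrC.
      move=> /(leC _ _ Lu); rewrite mulrCA divff ?gt_eqF// mulr1.
      rewrite (_ : (fun z => _ * _) = fun z =>
        -1 * (op (kernel_partial_sum Y a n) (Y j k) z * Y j' k' z) +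
        op K (Y j k) z * Y j' k' z); last first.
        by apply/funext => z; rewrite mulrDl mulrA.
      rewrite (complex_integral_scalar mS _ (in_L2_mul mS Ln HY'.1) (in_L2_mul mS opY.1 HY'.1)).
      (* Here the assumption enters: the image of [Y j k] is in degree [j], hence orthogonal to
         degree [j']. *)
      rewrite (integral_spherical_harmonicsM d_gt0 jj' opY HY') addr0.
      rewrite (partial_sum_coefficient d_gt0 Y_basis a k k' jn jn') mulN1r.
      by rewrite /abs1; case: (a _ _ _ _) => ? ? /=; rewrite !normrN.
    have : abs1 (a j j' k k') == 0.
      rewrite eq_le abs1_ge0 andbT; apply/ler_addgt0Pr => e e0; rewrite add0r; exact: small.
    rewrite paddr_eq0// !normr_eq0 => /andP[/eqP r0 /eqP i0].
    exact: complex_eqP.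
  (* [D] takes natural numbers as indices: [insub] recovers the ordinals, and the value out of range
     is 0 by default. *)
  exists (fun j m m' => if insub m is Some k then
    if insub m' is Some k' then a j j k k' else 0 else 0) => j j' k k'.
  have [jj'|jj'] := eqVneq j j'; last by rewrite a0// mul0r.
  by subst j'; rewrite !valK mul1r.
have a0 l l' (k : 'I_(N l)) (k' : 'I_(N l')) : l != l' -> a l l' k k' = 0.
  by move=> ll'; rewrite aD (negPf ll') mul0r.
(* The common value of the partial sum operators at [f] for all n > j, visibly a harmonic of degree
   [j]. *)
pose g z := \sum_(k' < N j)
  (\sum_(k < N j) a j j k k' * L2_inner (@surface_measure R d) (@sphere R d) (Y j k) f) *
  conjc (Y j k' z).
have Hg : spherical_harmonics j g.
  apply: (spherical_harmonics_sum (F := fun k' z => conjc (Y j k' z))) => k'.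
  by apply: spherical_harmonics_conj; exact: (basis_harmonic Y_basis).
have [[mg goo] [p hp gp]] := Hg.
have Tfg : (fun z => op K f z - g z) = (fun=> 0) %[ae (@surface_measure R d) in (@sphere R d)].
  apply: ae_eq0_abs1 => //.
    have := complex_measurable_scalar (-1) mg (mop f Hf.1).
    by under eq_fun do rewrite mulN1r addrC.
  (* Beyond both [n] and [j] the partial sum operator returns [g], so the L^1 bound on the error is
     a bound on the distance from [op K f] to [g]. *)
  move=> e e0; have [n _ /(_ (maxn n j.+1) (leq_maxl _ _))] := cvg f Hf.1 e e0.
  apply: le_trans; rewrite le_eqVlt; apply/orP; left; apply/eqP.
  apply: eq_integral => z _.
  by rewrite (diagonal_partial_sum_operator d_gt0 Y_basis z (leq_maxr n j.+1) a0 Hf).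
have opg : op K f = g %[ae (@surface_measure R d) in (@sphere R d)].
  by apply: filterS Tfg => z h Sz; apply/eqP; rewrite -subr_eq0 h.
(* Square integrability and the representing polynomial pass from [g] to [op K f] along almost
   everywhere equality; measurability is known separately. *)
split; first split; first exact: mop Hf.1.
  rewrite /sqr_L2norm (@ge0_ae_eq_integral _ _ _ _ _ _ (fun z => (Normc.normc (g z) ^+ 2)%:E))//.
  - exact/measurable_EFinP/measurable_sqr_normc/mop/Hf.1.
  - exact/measurable_EFinP/measurable_sqr_normc.
  - by move=> z _; rewrite lee_fin sqr_ge0.
  - by move=> z _; rewrite lee_fin sqr_ge0.
  - by apply: filterS opg => z h Sz; congr (Normc.normc _ ^+ 2)%:E; exact: h.
exists p => //; apply: filterS2 opg gp => z h1 h2 Sz.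
by rewrite -h2// -h1.
Qed.
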